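(* Fix $r\ge0$ and define the formal power series \[ S_r(X;a,b,c,q^{1/2})=\sum_{\lambda\in\mathcal P_r} a^{(o(\lambda)-o(\delta_r))/2}\,b^{(o(\lambda')-o(\delta_r))/2}\,c^{d(\lambda)-d(\delta_r)}\,G_\lambda(X;q). \] Then $S_r$ does not depend on $r$, and \[ S_r(X;a,b,c,q^{1/2})=\frac{\prod_i (1+aq^{1/2}x_i)}{\prod_i(1-bx_i)\,\prod_i(1-cqx_i^2)\,\prod_{i<j}(1-cx_ix_j)\,\prod_{i<j}(1-cqx_ix_j)}. \]
   Context: $X=(x_1,x_2,\dots)$ is a countable set of variables; $a,b,c$ are indeterminates. Partitions are identified with Young diagrams in English notation (rows numbered from the top, columns from the left); $\lambda'$ is the conjugate. A domino is a set of two cells sharing an edge (vertical if in one column). $\delta_r=(r,r-1,\dots,1)$; every partition has a 2-core (obtained by repeatedly removing dominoes while staying a partition) equal to a unique $\delta_r$; $\mathcal P_r$ is the set of partitions with 2-core $\delta_r$. A semistandard domino tableau of shape $\lambda$ with 2-core $\tilde\lambda$ is a tiling of $\lambda/\tilde\lambda$ by dominoes with a positive integer written in each domino, such that when each cell receives the number of its domino, entries weakly increase along rows and strictly increase down columns. Its weight is $x^D=\prod_i x_i^{\mu_i}$ where $\mu_i$ is the number of dominoes labelled $i$; its spin $sp(D)$ is half the number of vertical dominoes. The domino function is $G_\lambda(X;q)=\sum_D q^{sp(D)}x^D$, summed over all semistandard domino tableaux of shape $\lambda$. Statistics: $o(\lambda)$ is the number of odd parts of $\lambda$ (so $o(\lambda')$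 is the number of odd columns), and $d(\lambda)=\sum_{i=1}^{\lfloor l(\lambda)/2\rfloor}\lfloor\lambda_{2i}/2\rfloor$. *)

(* Defs.v *)
From HB Require Import structures.
From mathcomp Require Import all_boot all_order all_algebra.
From mathcomp Require Import mpoly.

Set Implicit Arguments.
Unset Strict Implicit.
Unset Printing Implicit Defensive.

Import Order.TTheory GRing.Theory.
(* Partitions are represented by their sequence of (positive) parts,   *)
(* weakly decreasing; row i (0-indexed) has length nth 0 la i.         *)

Definition delta (r : nat) : seq nat := rev (iota 1 r).

Definition drop0 (s : seq nat) : seq nat := [seq x <- s | (0 < x)%N].

(* All partitions obtained from la by removing one domino so that the   *)
(* result is still a partition: a horizontal domino at the end of row i *)
(* or a vertical domino at the end of rows i, i+1.                      *)
Definition domino_removals (la : seq nat) : seq (seq nat) :=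
  let l i := nth 0%N la i in
  flatten [seq
    (if (2 <= l i)%N && (l i.+1 <= l i - 2)%N
     then [:: drop0 (set_nth 0%N la i (l i - 2))] else [::]) ++
    (if (0 < l i)%N && (l i == l i.+1) && (l i.+2 <= l i.+1 - 1)%N
     then [:: drop0 (set_nth 0%N (set_nth 0%N la i (l i - 1)) i.+1 (l i.+1 - 1))]
     else [::])
  | i <- iota 0 (size la)].

(* the 2-core: repeatedly remove dominoes (staying a partition) until   *)
(* none can be removed; |la| removals always suffice.                   *)
Fixpoint core2_fuel (fuel : nat) (la : seq nat) : seq nat :=
  if fuel is k.+1 then
    if domino_removals la is mu :: _ then core2_fuel k mu else la
  else la.

Definition core2 (la : seq nat) : seq nat := core2_fuel (sumn la) la.

Definition inP (r : nat) (la : seq nat) : bool := core2 la == delta r.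

Definition conjp (la : seq nat) : seq nat :=
  [seq count (fun x => j <= x)%N la | j <- iota 1 (head 0%N la)].

Definition oddparts (la : seq nat) : nat := count odd la.

(* d(la) = sum_{i=1}^{floor(l/2)} floor(la_{2i}/2)  (1-indexed parts) *)
Definition dstat (la : seq nat) : nat :=
  (\sum_(1 <= i < (size la)./2.+1) (nth 0 la (i.*2.-1))./2)%N.

Definition in_diag (la : seq nat) (i j : nat) : bool := (j < nth 0 la i)%N.

Definition in_skew (la mu : seq nat) (i j : nat) : bool :=
  in_diag la i j && ~~ in_diag mu i j.

(* Domino tableaux with labels in {1..n} (label l+1 encoded by l : 'I_n). *)
(* A filling is a finite function on the grid 'I_M x 'I_M:             *)
(*   None          : cell not in the skew shape la/mu,                  *)
(*   Some (l, d)   : cell in the skew shape, labelled l, and the other  *)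
(*                   cell of its domino is in direction d:              *)
(*                   0 = right, 1 = left, 2 = below, 3 = above.         *)

Local Open Scope ring_scope.

Definition gridM (la : seq nat) : nat := (size la + head 0%N la).+1.

Section Domino.
Variables (R : comRingType) (n : nat) (la mu : seq nat).
Local Notation M := (gridM la).

Definition filling := {ffun 'I_M * 'I_M -> option ('I_n * 'I_4)}.

Definition getc (T : filling) (i j : nat) : option ('I_n * 'I_4) :=
  match insub i, insub j with
  | Some i', Some j' => T (i', j')
  | _, _ => None
  end.

Definition partner (i j : nat) (d : nat) : option (nat * nat) :=
  match d with
  | 0 => Some (i, j.+1)
  | 1 => if (0 < j)%N then Some (i, j.-1) else None
  | 2 => Some (i.+1, j)
  | 3 => if (0 < i)%N then Some (i.-1, j) else None
  | _ => None
  end.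

Definition opp_dir (d : nat) : nat :=
  match d with 0 => 1 | 1 => 0 | 2 => 3 | _ => 2 end%N.

Definition cell_ok (T : filling) (i j : nat) : bool :=
  match getc T i j with
  | None => ~~ in_skew la mu i j
  | Some (l, d) =>
      in_skew la mu i j &&
      match partner i j d with
      | None => false
      | Some (i2, j2) =>
          in_skew la mu i2 j2 &&
          match getc T i2 j2 with
          | None => false
          | Some (l2, d2) => (l2 == l) && (val d2 == opp_dir d)
          end
      end
  end.

(* semistandard: weakly increasing along rows, strictly increasing down *)
(* columns (between cells belonging to different dominoes).             *)
Definition row_ok (T : filling) (i j : nat) : bool :=
  match getc T i j, getc T i j.+1 with
  | Some (l1, _), Some (l2, _) => (val l1 <= val l2)%N
  | _, _ => true
  end.

Definition col_ok (T : filling) (i j : nat) : bool :=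
  match getc T i j, getc T i.+1 j with
  | Some (l1, d1), Some (l2, _) => (val d1 == 2%N) || (val l1 < val l2)%N
  | _, _ => true
  end.

Definition is_domino_tableau (T : filling) : bool :=
  [forall c : 'I_M * 'I_M,
     cell_ok T c.1 c.2 && row_ok T c.1 c.2 && col_ok T c.1 c.2].

Definition nvert (T : filling) : nat :=
  #|[pred c : 'I_M * 'I_M | if T c is Some (_, d) then val d == 2%N else false]|.

(* x^T : one factor x_l for each domino (counted at its top/left cell) *)
Definition xweight (T : filling) : {mpoly R[n]} :=
  \prod_(c : 'I_M * 'I_M)
     (if T c is Some (l, d) then
        (if (val d == 0%N) || (val d == 2%N) then 'X_l else 1)
      else 1).

(* skew domino function on la/mu restricted to x_1..x_n, with q^{1/2}=t: *)
(* q^{sp(T)} = q^{nvert/2} = t^{nvert}.                                  *)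
Definition Gskew (t : R) : {mpoly R[n]} :=
  \sum_(T : filling | is_domino_tableau T) (t ^+ nvert T) *: xweight T.

End Domino.

Definition Gdom (R : comRingType) (n : nat) (t : R) (la : seq nat) : {mpoly R[n]} :=
  Gskew n la (core2 la) t.

(* Truncations of S_r to x_1..x_n: all la in P_r with                 *)
(* |la| <= |delta_r| + 2N (these give all terms of x-degree <= N).      *)
(* Partitions with |la| <= K are encoded (injectively) by weakly        *)
(* decreasing functions 'I_K -> 'I_K.+1 (parts padded with zeros).      *)

Definition code_seq (K : nat) (f : {ffun 'I_K -> 'I_K.+1}) : seq nat :=
  [seq val (f i) | i <- enum 'I_K].

Definition code_part (K : nat) (f : {ffun 'I_K -> 'I_K.+1}) : seq nat :=
  drop0 (code_seq f).

Definition Str (R : comRingType) (a b c t : R) (r n N : nat) : {mpoly R[n]} :=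
  let K := (sumn (delta r) + N.*2)%N in
  \sum_(f : {ffun 'I_K -> 'I_K.+1} |
          sorted geq (code_seq f) && (sumn (code_part f) <= K)%N
          && inP r (code_part f))
    let la := code_part f in
    (a ^+ ((oddparts la - oddparts (delta r))./2) *
     b ^+ ((oddparts (conjp la) - oddparts (conjp (delta r)))./2) *
     c ^+ (dstat la - dstat (delta r))) *: Gdom n t la.

Definition trunc_eq (R : comRingType) (n N : nat) (p q : {mpoly R[n]}) : Prop :=
  forall m : 'X_{1..n}, (mdeg m <= N)%N -> p@_m = q@_m.

Definition Snum (R : comRingType) (n : nat) (a t : R) : {mpoly R[n]} :=
  \prod_(i < n) (1 + (a * t) *: 'X_i).

Definition Sden (R : comRingType) (n : nat) (b c t : R) : {mpoly R[n]} :=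
  (\prod_(i < n) (1 - b *: 'X_i)) *
  (\prod_(i < n) (1 - (c * t ^+ 2) *: ('X_i ^+ 2))) *
  (\prod_(i < n) \prod_(j < n | (i < j)%N) (1 - c *: ('X_i * 'X_j))) *
  (\prod_(i < n) \prod_(j < n | (i < j)%N) (1 - (c * t ^+ 2) *: ('X_i * 'X_j))).

(* Main.v *)
(** A partition is encoded by a word of beads (row ends) and holes (column
    ends) read along its boundary; adding a domino moves a bead two places
    to the right, and the domino is vertical exactly when the bead jumps
    over another one. All dominoes with a given label are added in one sweep
    along the word whose only memory is two bits (beads in transit), so skew
    one-label tableaux are computed by a finite transfer matrix. Two facts
    about it are finite polynomial identities: a 16 x 16 matrix intertwines
    adding a strip of weight y and then removing one of weight x with the
    opposite order, which yields a Cauchy identity with factor (1 - x y)(1 -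
    t^2 x y), and 4 x 4 matrices, indexed by two parities, intertwine adding
    with removing a strip under the weight al^(odd rows) be^(odd columns),
    which yields a one-variable Littlewood identity. Adding the variables
    one at a time, the 2-core having no removable strip, gives the product
    formula for c = 1, up to terms of high degree. The parameter c is
    restored by homogeneity: on partitions with a fixed 2-core, 4 d + o + o'
    - |la| is constant, so a = al^2 ga, b = be^2 ga, c = ga^2 and x_i
    replaced by ga x_i reduce to that case; these substitutions are
    injective on polynomials in a, b, c. *)

From HB Require Import structures.
From mathcomp Require Import all_boot all_order all_algebra.
From mathcomp Require Import mpoly ring zify.
Require Import Defs.
Set Implicit Arguments.
Unset Strict Implicit.
Unset Printing Implicit Defensive.

(** * Strips between bead words *)

(** All words have one fixed length, so that every sum is finite; the difficulty then sits at the
    two ends of this window. An intertwiner relates the sweeps for all values of the transit bits,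
    while at the ends only zero bits are wanted. On the left, two leading beads make the unwanted
    entries add up to a scalar: 1 for the Cauchy identity, the numerator [1 + al ^+ 2 * t * x] times
    [be ^+ 2] for the Littlewood one. On the right, strips that would leave the window are lost and
    nothing cancels exactly; but over trailing holes a bead in transit must keep jumping, each jump
    costs a variable, and the defect moves to high degree. This is why the identities are stated
    with [ordge] and [eq_upto], and why words are padded by two beads and [N.+1.*2] holes. The
    weight of a word counts odd rows and columns absolutely, so it exceeds the wanted monomial by
    the weight of the core; dividing by it, and by the [be ^+ 2] in [Kden], requires regular
    elements. Hence the product formula is proved with indeterminates for [al] and [be], and only
    then specialised. *)

Fixpoint words (n : nat) : seq (seq bool) :=
  if n is n'.+1 then map (cons true) (words n') ++ map (cons false) (words n')
  else [:: [::]].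

Lemma mem_words n s : (s \in words n) = (size s == n).
Proof.
elim: n s => [|n IH] [|b s] //=.
  by rewrite mem_cat; apply/negP => /orP [] /mapP [? _].
have Hinj c : injective (cons c : seq bool -> _) by move=> u v [].
rewrite mem_cat eqSS -IH.
case: b.
  rewrite mem_map //; apply/orP/idP => [[//|/mapP [? _ //]]|]; by left.
rewrite (mem_map (Hinj false)); apply/orP/idP => [[/mapP [? _ //]|//]|]; by right.
Qed.

Lemma words_uniq n : uniq (words n).
Proof.
elim: n => //= n IH; rewrite cat_uniq !map_inj_uniq ?IH /= ?andbT; try by move=> u v [].
by apply/hasPn => s /mapP [u _ ->]; apply/negP => /mapP [].
Qed.

(** [r] and [l] are the bits of the smaller and of the larger word at the current
    position and [a] tells whether a bead in transit arrives there; [nxt] tells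
    whether a bead leaves this position towards the one two places further. *)
Definition nxt (r l a : bool) : bool := (r || a) && ~~ l.
Definition step_ok (r l a : bool) : bool := ~~ (r && a) && (l ==> (r || a)).

(** [Some (i, j)] when [l] is obtained from [r] by a strip of [i] dominoes, [j] of
    them vertical; [a] and [a'] are the arrivals at the first two positions. *)
Fixpoint sexp (l r : seq bool) (a a' : bool) : option (nat * nat) :=
  match l, r with
  | [::], [::] => if a || a' then None else Some (0, 0)%N
  | l0 :: l', r0 :: r' =>
      if step_ok r0 l0 a then
        if sexp l' r' a' (nxt r0 l0 a) is Some (i, j)
        then Some (nxt r0 l0 a + i, (a' && (r0 || a)) + j)%N else None
      else None
  | _, _ => None
  end.

Fixpoint possum (s : seq bool) (c : nat) : nat :=
  if s is b :: s' then (b * c + possum s' c.+1)%N else 0%N.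

Fixpoint oddbeads (s : seq bool) (c : bool) : nat :=
  if s is b :: s' then (b && c + oddbeads s' (~~ c))%N else 0%N.

Lemma step_okP r l a : step_ok r l a -> (l + nxt r l a = r + a)%N.
Proof. by case: r; case: l; case: a. Qed.

(** A bead in transit is counted at the place where it will arrive, [c] or [c.+1], and every later
    departure adds two. *)
Lemma sexp_possum l r a a' i j c : sexp l r a a' = Some (i, j) ->
  possum l c = (possum r c + a * c + a' * c.+1 + i.*2)%N.
Proof.
elim: l r a a' c i j => [|l0 l IH] [|r0 r] a a' c i j //=.
  by case: ifP => // /norP [/negbTE -> /negbTE ->] [<- _].
case: ifP => // /step_okP H; case E: (sexp _ _ _ _) => [[i' j']|] // [<- _].
rewrite (IH _ _ _ _ _ _ E).
by clear E; move: H; case: l0; case: r0; case: a; case: a'; rewrite /nxt /= => H; lia.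
Qed.

Lemma sexp_count l r a a' e : sexp l r a a' = Some e ->
  count id l = (count id r + a + a')%N.
Proof.
elim: l r a a' e => [|l0 l IH] [|r0 r] a a' e //=; first by case: a; case: a'.
case: ifP => // /step_okP H; case E: (sexp _ _ _ _) => [[i' j']|] // _.
rewrite (IH _ _ _ _ E); lia.
Qed.

(** Moves by two places keep the parity of a bead's position; this is how a word remembers its
    2-core, see [oddalt_oddbeads]. *)
Lemma sexp_oddbeads l r a a' e c : sexp l r a a' = Some e ->
  oddbeads l c = (oddbeads r c + (a && c) + (a' && ~~ c))%N.
Proof.
elim: l r a a' e c => [|l0 l IH] [|r0 r] a a' e c //=; first by case: a; case: a'.
case: ifP => // /step_okP H; case E: (sexp _ _ _ _) => [[i' j']|] // _.
rewrite (IH _ _ _ _ _ E).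
by clear E; move: H; case: l0; case: r0; case: a; case: a'; case: c; rewrite /nxt /= => H; lia.
Qed.

(** * Row description of strips *)

Fixpoint parts (h : nat) (s : seq bool) : seq nat :=
  match s with
  | [::] => [::]
  | true :: s' => h :: parts h s'
  | false :: s' => parts h.+1 s'
  end.

Definition oadd (u v : nat) (o : option (nat * nat)) : option (nat * nat) :=
  if o is Some (i, j) then Some (u + i, v + j) else None.

Lemma oadd_oadd u v u' v' o : oadd u v (oadd u' v' o) = oadd (u + u') (v + v') o.
Proof. by case: o => [[i j]|] //=; rewrite !addnA. Qed.

(** Row lengths are listed from bottom to top.  The head of [Q] is the column up to
    which its row is already filled, counting the top halves of the vertical
    dominoes shared with the row below. *)
Fixpoint rowexp (P Q : seq nat) : option (nat * nat) :=
  match P, Q with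
  | [::], [::] => Some (0, 0)
  | p :: P', q :: Q' =>
      let e := if Q' is q' :: _ then minn p q' else p in
      if (q <= e) && ~~ odd (e - q) then
        oadd ((p - e) + (e - q)./2) (p - e)
          (rowexp P' (if Q' is q' :: Q'' then maxn q' p :: Q'' else [::]))
      else None
  | _, _ => None
  end.

(** A sweep in progress is the same as a row computation in which the rows whose
    bead is in transit have been filled up to these columns. *)
Definition pend (k : nat) (a a' : bool) : seq nat :=
  match a, a' with
  | false, false => [::]
  | true, false => [:: k.+1]
  | false, true => [:: k]
  | true, true => [:: k.+1; k.+1]
  end.

Definition lbound (k : nat) (s : seq nat) := if s is q :: _ then k <= q else true.

Lemma lbound_parts k s : lbound k (parts k s).
Proof.
elim: s k => //= -[] s IH k //=.
by have := IH k.+1; rewrite /lbound; case: (parts _ _) => // q _ /ltnW.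
Qed.

(** Here [k] and [c] count the holes already read in the smaller and in the larger word; they differ
    by the number of beads in transit. The two [lbound] hypotheses decide the minima and maxima in
    [rowexp]. *)
Lemma rowexp_step c k (a a' l0 r0 : bool) P Q : c = k + a + a' ->
  lbound (c + ~~ l0) P -> lbound (k + ~~ r0) Q ->
  rowexp (if l0 then c :: P else P) (pend k a a' ++ (if r0 then k :: Q else Q)) =
  if step_ok r0 l0 a then
    oadd a' (a' && (r0 || a)) (rowexp P (pend (k + ~~ r0) a' (nxt r0 l0 a) ++ Q))
  else None.
Proof.
have oadd00 o : oadd 0 0 o = o by case: o => [[]|].
move=> ->; case: l0; case: r0; case: a; case: a' => //=;
 rewrite /nxt /= ?addn0 ?addn1 ?oadd00; case: P => [|p P]; case: Q => [|q Q] //= => HP HQ;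
 rewrite ?oadd_oadd.
all: try (case: Q HQ => [|q' Q] HQ).
all: try by repeat (case: ifP => //=; try lia).
all: repeat (case: ifP => //=; try lia).
all: move=> *; rewrite ?oadd_oadd.
all: first [by congr (Some (_, _)); lia | by congr (oadd _ _ _); lia |
  by congr (oadd _ _ (rowexp _ (_ :: _))); lia | idtac].
all: by case: P => [|p' P] //=; case: ifP => //; lia.
Qed.

(** The shift by [a'] compares two bookkeepings: the sweep counts a domino when its bead leaves,
    whereas the pending rows still have to count the domino of a bead due at the next position. *)
Lemma sexp_rowexp (k : nat) (a a' : bool) l r : size l = size r ->
  oadd a' 0 (sexp l r a a') = rowexp (parts (k + a + a') l) (pend k a a' ++ parts k r).
Proof.
elim: l r k a a' => [|l0 l IH] [|r0 r] k a a' //; first by case: a; case: a'.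
case=> E.
have -> : parts (k + a + a') (l0 :: l) =
    if l0 then (k + a + a') :: parts (k + a + a' + ~~ l0) l else parts (k + a + a' + ~~ l0) l.
  by case: l0 => /=; rewrite ?addn0 ?addn1.
have -> : parts k (r0 :: r) = if r0 then k :: parts (k + ~~ r0) r else parts (k + ~~ r0) r.
  by case: r0 => /=; rewrite ?addn0 ?addn1.
rewrite rowexp_step // ?lbound_parts // [sexp _ _ _ _]/=.
case: ifP => // /step_okP H.
have -> : k + a + a' + ~~ l0 = k + ~~ r0 + a' + nxt r0 l0 a.
  by move: H; case: (l0); case: (r0); lia.
rewrite -IH // oadd_oadd.
by case: (sexp _ _ _ _) => [[i j]|] //=; congr (Some (_, _)); lia.
Qed.

Lemma sexp_parts l r : size l = size r ->
  sexp l r false false = rowexp (parts 0 l) (parts 0 r).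
Proof. by move/(sexp_rowexp 0 false false) => <-; case: (sexp _ _ _ _) => [[]|]. Qed.

Definition rowlen (s : seq bool) (i : nat) : nat := nth 0 (rev (parts 0 s)) i.

Fixpoint down (f : nat -> nat) (k : nat) : seq nat :=
  if k is k'.+1 then f k' :: down f k' else [::].

Lemma size_parts h s : size (parts h s) = count id s.
Proof. by elim: s h => //= -[] s IH h /=; rewrite IH. Qed.

Lemma eq_down f g k : (forall i, i < k -> f i = g i) -> down f k = down g k.
Proof. by elim: k => //= k IH H; rewrite H // IH // => i ik; apply/H/ltnW. Qed.

Lemma parts_down s : parts 0 s = down (rowlen s) (count id s).
Proof.
rewrite /rowlen -(size_parts 0).
elim: (parts 0 s) => //= p P IH; rewrite rev_cons nth_rcons size_rev ltnn eqxx; congr cons.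
rewrite {1}IH; apply: eq_down => i ik; by rewrite nth_rcons size_rev ik.
Qed.

(** In row [i] of the strip [f]/[g], cells before [seg_lo] are top halves of vertical dominoes,
    cells from [seg_hi] on are bottom halves, and horizontal dominoes fill the space between. *)
Definition seg_lo (f g : nat -> nat) i := maxn (g i) (f i.+1).
Definition seg_hi (f g : nat -> nat) i := if i is i'.+1 then minn (f i) (g i') else f i.
Definition gap_ok (f g : nat -> nat) i := (seg_lo f g i <= seg_hi f g i) && ~~ odd (seg_hi f g i - seg_lo f g i).

Lemma rowexp_down f g k :
  rowexp (down f k.+1) (seg_lo f g k :: down g k) =
  if all (gap_ok f g) (iota 0 k.+1) then
    Some (\sum_(i < k.+1) ((f i - seg_hi f g i) + (seg_hi f g i - seg_lo f g i)./2),
          \sum_(i < k.+1) (f i - seg_hi f g i))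
  else None.
Proof.
rewrite -[in iota _ _]addn1 iotaD all_cat add0n.
elim: k => [|k IH].
  rewrite !big_ord1 /= /gap_ok /=; case: ifP => //= _.
  by rewrite !addn0.
have -> : rowexp (down f k.+2) (seg_lo f g k.+1 :: down g k.+1) =
  if gap_ok f g k.+1 then
    oadd ((f k.+1 - seg_hi f g k.+1) + (seg_hi f g k.+1 - seg_lo f g k.+1)./2) (f k.+1 - seg_hi f g k.+1)
      (rowexp (down f k.+1) (seg_lo f g k :: down g k)) else None by [].
rewrite IH -[in iota _ k.+1]addn1 iotaD all_cat.
rewrite [all _ (iota k.+1 1)]/= andbT [all _ (iota k 1)]/= andbT.
case: (gap_ok _ _ k.+1); last by rewrite andbF.
rewrite andbT; case: ifP => // _; rewrite /oadd; congr (Some (_, _)); by rewrite [RHS]big_ord_recr addnC.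
Qed.

Lemma rowexp_rows f g k : f k = 0 ->
  rowexp (down f k) (down g k) =
  if all (gap_ok f g) (iota 0 k) then
    Some (\sum_(i < k) ((seg_lo f g i - g i) + (seg_hi f g i - seg_lo f g i)./2),
          \sum_(i < k) (seg_lo f g i - g i))
  else None.
Proof.
case: k => [|k] fk; first by rewrite /= !big_ord0.
have lok : seg_lo f g k = g k by rewrite /seg_lo fk maxn0.
(* Vertical dominoes are counted once by bottom halves and once by top halves; row 0 has no bottom
   half, and the last row no top half since [f k = 0]. *)
have sh : \sum_(i < k.+1) (f i - seg_hi f g i) = \sum_(i < k.+1) (seg_lo f g i - g i).
  rewrite big_ord_recl big_ord_recr /= lok !subnn add0n addn0.
  apply: eq_bigr => i _; rewrite /bump leq0n add1n /seg_hi /seg_lo add0n; lia.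
rewrite [down g _]/= -{1}lok rowexp_down; case: ifP => // _.
by rewrite sh !big_split /= sh.
Qed.

Lemma rowlen_ge s i : count id s <= i -> rowlen s i = 0.
Proof. by move=> H; rewrite /rowlen nth_default // size_rev size_parts. Qed.

Lemma sexp_rows l r : size l = size r -> count id l = count id r ->
  sexp l r false false =
  if all (gap_ok (rowlen l) (rowlen r)) (iota 0 (count id l)) then
    Some (\sum_(i < count id l) ((seg_lo (rowlen l) (rowlen r) i - rowlen r i) +
                                  (seg_hi (rowlen l) (rowlen r) i - seg_lo (rowlen l) (rowlen r) i)./2),
          \sum_(i < count id l) (seg_lo (rowlen l) (rowlen r) i - rowlen r i))
  else None.
Proof.
by move=> E C; rewrite sexp_parts // !parts_down -C rowexp_rows // rowlen_ge.
Qed.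

Lemma rowlen_decr s i : rowlen s i.+1 <= rowlen s i.
Proof.
rewrite /rowlen; have := lbound_parts 0 s.
have : sorted leq (parts 0 s).
  elim: s 0 => //= -[] s IH h //=; have := lbound_parts h s; have := IH h.
  by case: (parts h s) => //= q Q -> ->.
move=> H _; have [ik|ik] := ltnP i.+1 (size (parts 0 s)); last first.
  by rewrite nth_default // size_rev.
rewrite !nth_rev ?(ltnW ik) //.
apply: (sorted_leq_nth leq_trans leqnn 0 H); rewrite ?inE; lia.
Qed.

Lemma rowlen_bound s i : rowlen s i + count id s <= size s.
Proof.
have H h : forall x, x \in parts h s -> x + count id s <= h + size s.
  elim: s h => //= -[] s IH h x /=; last by move/IH; lia.
  by rewrite inE => /orP [/eqP -> |/IH]; have := count_size id s; lia.
have [ik|ik] := ltnP i (count id s); last by rewrite rowlen_ge // count_size.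
by have := H 0 (rowlen s i); rewrite add0n; apply; rewrite -mem_rev; apply/mem_nth; rewrite size_rev size_parts.
Qed.

Lemma parts_inj h s s' : size s = size s' -> parts h s = parts h s' -> s = s'.
Proof.
elim: s s' h => [|[] s IH] [|[] s'] h //= [E].
- by case=> /(IH _ _ E) ->.
- by move=> H; have := lbound_parts h.+1 s'; rewrite -H /= ltnn.
- by move=> H; have := lbound_parts h.+1 s; rewrite H /= ltnn.
- by move/(IH _ _ E) ->.
Qed.

Lemma rowlen_inj s s' : size s = size s' -> count id s = count id s' ->
  (forall i, i < count id s -> rowlen s i = rowlen s' i) -> s = s'.
Proof.
move=> E C H; apply: (@parts_inj 0) => //.
by rewrite !parts_down -C; apply: eq_down.
Qed.

(** Inverse of [parts]: the rows [f k.-1], ..., [f 0] are written from the bottom up, starting at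
    column [c] and closing with holes up to column [C]. *)
Fixpoint word_of (c C : nat) (f : nat -> nat) (k : nat) : seq bool :=
  if k is k'.+1 then nseq (f k' - c) false ++ true :: word_of (f k') C f k'
  else nseq (C - c) false.

Lemma parts_nseq h k s : parts h (nseq k false ++ s) = parts (h + k) s.
Proof. by elim: k h => [|k IH] h /=; rewrite ?addn0 // IH addSnnS. Qed.

Lemma word_of_spec c C f k : (forall i, f i.+1 <= f i) -> (forall i, i < k -> c <= f i <= C) ->
  c <= C ->
  [/\ size (word_of c C f k) = k + (C - c), count id (word_of c C f k) = k &
      parts c (word_of c C f k) = down f k].
Proof.
move=> fd; elim: k c => [|k IH] c H cC /=.
  rewrite size_nseq count_nseq mul0n; split=> //.
  by rewrite -[nseq _ _]cats0 parts_nseq.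
have fk := H k (ltnSn k).
have {}IH : [/\ size (word_of (f k) C f k) = k + (C - f k), count id (word_of (f k) C f k) = k &
      parts (f k) (word_of (f k) C f k) = down f k].
  apply: IH; last by case/andP: fk.
  move=> i ik; have /andP [_ ->] := H i (leqW ik); rewrite andbT.
  rewrite -(subnK (ltnW ik)); elim: (k - i) => [|j IHj]; first exact: leqnn.
  by apply: leq_trans IHj; rewrite addSn; apply: fd.
case: IH => I1 I2 I3; split.
- by rewrite size_cat size_nseq /= I1; lia.
- by rewrite count_cat count_nseq mul0n /= I2.
- by rewrite parts_nseq /= subnKC ?I3; case/andP: fk.
Qed.

Lemma word_of_rows C f k : (forall i, f i.+1 <= f i) -> f 0 <= C -> f k = 0 ->
  let s := word_of 0 C f k in
  [/\ size s = k + C, count id s = k & forall i, rowlen s i = f i].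
Proof.
move=> fd fC fk s.
have fi i j : f (j + i) <= f i.
  by elim: j => // j IH; apply: leq_trans IH; rewrite addSn; apply: fd.
have [||S1 S2 S3] := @word_of_spec 0 C f k fd; rewrite ?leq0n //.
  by move=> i _; apply: leq_trans fC; have := fi 0 i; rewrite addn0.
split=> //; first by rewrite S1 subn0.
move=> i; have [ik|ik] := ltnP i k; last first.
  by rewrite rowlen_ge ?S2 //; have := fi k (i - k); rewrite subnK // fk; case: (f i).
rewrite /rowlen S3.
elim: k ik {fk S1 S2 S3 s} => // k IH; rewrite ltnS /= rev_cons nth_rcons size_rev.
have -> : forall j, size (down f j) = j by elim=> //= j ->.
by rewrite leq_eqVlt => /orP [/eqP ->|ik]; rewrite ?ltnn ?eqxx // ik IH.
Qed.

(** * One label of a domino tableau *)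

Section Layer.
Variable n : nat.
Implicit Types (f g mu : nat -> nat) (G : nat -> nat -> option ('I_n * 'I_4)).

Definition decr f := forall i, f i.+1 <= f i.

Record tableau f mu (k : nat) G : Prop := Tableau {
  tab_cell : forall i j l d, G i j = Some (l, d) ->
    [/\ l < k, mu i <= j < f i & exists i2 j2 d2,
      [/\ partner i j d = Some (i2, j2), G i2 j2 = Some (l, d2) & val d2 = opp_dir d] ];
  tab_some : forall i j, mu i <= j < f i -> exists l d, G i j = Some (l, d);
  tab_row : forall i j l1 d1 l2 d2, G i j = Some (l1, d1) -> G i j.+1 = Some (l2, d2) -> l1 <= l2;
  tab_col : forall i j l1 d1 l2 d2, G i j = Some (l1, d1) -> G i.+1 j = Some (l2, d2) ->
    (val d1 == 2) || (l1 < l2) }.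

Definition lt_lab (k : nat) (o : option ('I_n * 'I_4)) : bool :=
  if o is Some (l, _) then l < k else false.

(** Directions are coded as in [Defs]: 0 right, 1 left, 2 below, 3 above. *)
Definition dirn f g i j : nat :=
  if j < seg_lo f g i then 2 else if seg_hi f g i <= j then 3 else odd (j - seg_lo f g i).

Definition glue f g (l : 'I_n) G i j : option ('I_n * 'I_4) :=
  if g i <= j < f i then Some (l, inord (dirn f g i j)) else G i j.

Definition restr k G i j := if lt_lab k (G i j) then G i j else None.

Lemma dirn_lt f g i j : dirn f g i j < 4.
Proof. by rewrite /dirn; do !case: ifP => // _; case: odd. Qed.

Lemma val_dirn f g i j : val (inord (dirn f g i j) : 'I_4) = dirn f g i j.
Proof. by rewrite /= inordK // dirn_lt. Qed.

(** * Removing the largest label from a tableau *)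

Section Analysis.
Variables (f g mu : nat -> nat) (k : nat) (G : nat -> nat -> option ('I_n * 'I_4)).
Hypotheses (fd : decr f) (mud : decr mu) (muf : forall i, mu i <= f i).
Hypothesis T : tableau f mu k.+1 G.
Hypothesis gE : forall i j, (j < g i) = (j < mu i) || lt_lab k (G i j).

Let D i j : nat := if G i j is Some (_, d) then val d else 4.

Lemma layer_le i : g i <= f i.
Proof.
rewrite leqNgt; apply/negP; rewrite gE ltnNge muf /= /lt_lab.
case E: (G _ _) => [[l d]|] // _; have [_] := tab_cell T E; by rewrite ltnn andbF.
Qed.

Lemma layer_ge i : mu i <= g i.
Proof. by rewrite leqNgt; apply/negP => H; have := gE i (g i); rewrite H ltnn. Qed.

(** A label below [k] underneath a cell outside [g] would violate strictness down the column, unless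
    both cells form one vertical domino; but then their labels agree. *)
Lemma layer_decr : decr g.
Proof.
move=> i; rewrite leqNgt; apply/negP => H.
have := gE i (g i); rewrite ltnn => /esym /norP [H1 H2].
move: H; rewrite gE => /orP [H|].
  by move: H1; rewrite (leq_trans H (mud i)).
rewrite /lt_lab; case E: (G i.+1 _) => [[l d]|] // lk.
have [_ /andP [_ jf] _] := tab_cell T E.
have [|l' [d' E']] := @tab_some _ _ _ _ T i (g i); first by rewrite layer_ge (leq_trans jf (fd i)).
have := tab_col T E' E; case/orP => [/eqP d2|l12].
  have [_ _ [i2 [j2 [d3 [P E2 _]]]]] := tab_cell T E'.
  move: P; rewrite d2 /= => -[i2E j2E]; move: E2; rewrite -i2E -j2E E => -[ll _].
  by move: H2; rewrite /lt_lab E' -ll lk.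
by move: H2; rewrite /lt_lab E' (ltn_trans l12 lk).
Qed.

Lemma layer_cell i j : g i <= j < f i ->
  exists l d, [/\ G i j = Some (l, d), val l = k & D i j = d].
Proof.
case/andP => gj jf; have [|l [d E]] := @tab_some _ _ _ _ T i j.
  by rewrite jf (leq_trans (layer_ge i) gj).
exists l, d; split=> //; last by rewrite /D E.
have [lk _ _] := tab_cell T E; move: gj; rewrite leqNgt gE negb_or /lt_lab E => /andP [_].
by move: lk; rewrite ltnS -leqNgt => *; apply/eqP; rewrite eqn_leq; apply/andP.
Qed.

Lemma cell_layer i j l d : G i j = Some (l, d) -> val l = k -> g i <= j < f i.
Proof.
move=> E lk; have [_ /andP [mj ->] _] := tab_cell T E.
by rewrite andbT leqNgt gE /lt_lab E lk ltnn ltnNge mj.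
Qed.

Lemma D_lt4 i j : g i <= j < f i -> D i j < 4.
Proof. by move/layer_cell => [l [d [_ _ ->]]]; apply: ltn_ord. Qed.

Lemma D_partner i j : g i <= j < f i -> exists i2 j2,
  [/\ partner i j (D i j) = Some (i2, j2), g i2 <= j2 < f i2 & D i2 j2 = opp_dir (D i j)].
Proof.
move=> /layer_cell [l [d [E lk ->]]].
have [_ _ [i2 [j2 [d2 [P E2 O]]]]] := tab_cell T E.
exists i2, j2; split=> //; first exact: cell_layer E2 lk.
by rewrite /D E2.
Qed.

(** Two stacked cells with the same label can only be the halves of a vertical domino. All
    directions inside a layer are forced by this fact. *)
Lemma D_below i j : g i <= j < f i -> g i.+1 <= j < f i.+1 -> D i j = 2 /\ D i.+1 j = 3.
Proof.
move=> H1 H2; have [l [d [E lk D1]]] := layer_cell H1.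
have [l' [d' [E' lk' _]]] := layer_cell H2.
have := tab_col T E E'; rewrite lk lk' ltnn orbF => /eqP dE.
have [i2 [j2 []]] := D_partner H1; rewrite D1 dE /= => -[<- <-] _ ->; by [].
Qed.

Lemma mid_layer i j : seg_lo f g i <= j < seg_hi f g i ->
  [/\ g i <= j < f i, (g i.+1 <= j < f i.+1) = false &
      forall i', i = i'.+1 -> (g i' <= j < f i') = false].
Proof. by rewrite /seg_lo /seg_hi; case: i => [|i'] H; split=> //; first [lia | move=> i2 [<-]; lia]. Qed.

Lemma D_mid01 i j : seg_lo f g i <= j < seg_hi f g i -> D i j = 0 \/ D i j = 1.
Proof.
move=> /mid_layer [H1 H2 H3]; have := D_lt4 H1; have [i2 [j2 [P C _]]] := D_partner H1.
move: P; case: (D i j) => [|[|[|[|//]]]]; [by left | by right | move=> /= [E1 E2] _ | move=> /=].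
  by move: C; rewrite -E1 -E2 H2.
case: i H1 H2 H3 => // i' H1 H2 H3 [E1 E2] _.
by move: C; rewrite -E1 -E2 /= H3.
Qed.

Lemma D_mid0 i j : seg_lo f g i <= j < seg_hi f g i -> D i j = 0 ->
  j.+1 < seg_hi f g i /\ D i j.+1 = 1.
Proof.
move=> Hm D0; have [H1 H2 H3] := mid_layer Hm.
have [i2 [j2 []]] := D_partner H1; rewrite D0 /= => -[<- <-] C D1; split=> //.
rewrite ltnNge; apply/negP => U; move: U C D1; rewrite /seg_hi.
case: i Hm D0 H1 H2 H3 => [|i'] _ _ _ _ _; first by lia.
move=> U C D1; have L : g i' <= j.+1 < f i' by have := fd i'; lia.
by have [_] := D_below L C; rewrite D1.
Qed.

(** Induction from the left. The first cell cannot have a left partner: that cell would lie in the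
    strip with another strip cell below it, hence be half of a vertical domino. Each later pair
    starts where the previous one is closed. *)
Lemma D_mid i m : seg_lo f g i + m.*2 < seg_hi f g i ->
  [/\ D i (seg_lo f g i + m.*2) = 0, (seg_lo f g i + m.*2).+1 < seg_hi f g i &
      D i (seg_lo f g i + m.*2).+1 = 1].
Proof.
elim: m => [|m IH] H.
  rewrite double0 addn0 in H *.
  have Hm : seg_lo f g i <= seg_lo f g i < seg_hi f g i by rewrite leqnn.
  have [D0|D1] := D_mid01 Hm; first by have [] := D_mid0 Hm D0.
  have [H1 H2 H3] := mid_layer Hm.
  have [i2 [j2 []]] := D_partner H1; rewrite D1 /=; case: (ltnP 0 (seg_lo f g i)) => // L [<- <-] C D0.
  have C' : g i.+1 <= (seg_lo f g i).-1 < f i.+1.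
    by move: C H2 L; have := layer_decr i; rewrite /seg_lo; lia.
  by have [] := D_below C C'; rewrite D0.
have [|D0 L D1] := IH; first by move: H; rewrite doubleS; lia.
have Hm : seg_lo f g i <= seg_lo f g i + (m.+1).*2 < seg_hi f g i by rewrite H andbT leq_addr.
have [D0'|D1'] := D_mid01 Hm; first by have [] := D_mid0 Hm D0'.
have [H1 H2 H3] := mid_layer Hm.
have [i2 [j2 []]] := D_partner H1; rewrite D1' /=; case: ifP => // _ [<- <-] _.
by rewrite doubleS !addnS /= D1.
Qed.

Lemma layer_gap_ok i : gap_ok f g i.
Proof.
have [[gf gd] fi] := (layer_le i, layer_decr, fd i).
have lu : seg_lo f g i <= seg_hi f g i.
  rewrite /seg_lo /seg_hi; case: i gf fi => [|i'] gf fi; first by rewrite geq_max gf.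
  rewrite geq_max !leq_min gf gd fi /= leqNgt; apply/negP => L.
  (* Otherwise three stacked cells carry the label [k], and the middle one is the lower half of one
     domino and the upper half of another. *)
  have [l1 l2 l3] : [/\ g i' <= g i' < f i', g i'.+1 <= g i' < f i'.+1 & g i'.+2 <= g i' < f i'.+2].
    by have [[a1 a2] a3] := (fd i', layer_decr i', layer_decr i'.+1); split; lia.
  have [_ D3] := D_below l1 l2; have [D2 _] := D_below l2 l3; by rewrite D2 in D3.
rewrite /gap_ok lu /=; apply/negP => od.
have [|_ + _] := @D_mid i (seg_hi f g i - seg_lo f g i)./2; by lia.
Qed.

Lemma layer_dir i j : g i <= j < f i -> D i j = dirn f g i j.
Proof.
move=> H; rewrite /dirn; case: ltnP => [L|L].
  have C : g i.+1 <= j < f i.+1 by have := layer_decr i; move: L; rewrite /seg_lo; lia.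
  by have [] := D_below H C.
case: leqP => U.
  case: i H L U => [|i'] H L; rewrite /seg_hi => U; first by lia.
  have C : g i' <= j < f i' by have := fd i'; lia.
  by have [] := D_below C H.
have E := odd_double_half (j - seg_lo f g i).
case: (odd _) E => E.
  have := @D_mid i (j - seg_lo f g i)./2.
  have -> : (seg_lo f g i + (j - seg_lo f g i)./2.*2).+1 = j by lia.
  by case=> //; lia.
have := @D_mid i (j - seg_lo f g i)./2.
have -> : (seg_lo f g i + (j - seg_lo f g i)./2.*2) = j by lia.
by case.
Qed.

(** Since directions in the top layer are forced, the two shapes and the smaller labels determine
    the whole filling. *)
Lemma layer_glue (l : 'I_n) i j : val l = k -> glue f g l (restr k G) i j = G i j.
Proof.
move=> lk; rewrite /glue; case: ifP => H.
  have [l' [d [E lk' D1]]] := layer_cell H; rewrite E; congr (Some (_, _)).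
    by apply: val_inj; rewrite lk.
  by apply: val_inj; rewrite val_dirn -layer_dir.
rewrite /restr /lt_lab; case E: (G i j) => [[l' d]|] //; case: ltnP => // L.
have [lk' /andP [mj jf] _] := tab_cell T E.
have ll : val l' = k by apply/eqP; rewrite eqn_leq L -ltnS lk'.
by rewrite (cell_layer E ll) in H.
Qed.

Lemma layer_restr : tableau g mu k (restr k G).
Proof.
split.
- move=> i j l d; rewrite /restr; case: ifP => // lk E.
  have [_ /andP [mj jf] [i2 [j2 [d2 [P E2 O]]]]] := tab_cell T E.
  split; first by rewrite /lt_lab E in lk.
    by rewrite mj gE lk orbT.
  exists i2, j2, d2; split=> //; rewrite E2 /= ; by rewrite /lt_lab E in lk; rewrite lk.
- move=> i j /andP [mj]; rewrite gE ltnNge mj /= /restr => L; rewrite L.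
  by move: L; rewrite /lt_lab; case: (G i j) => [[l d]|] // _; exists l, d.
- move=> i j l1 d1 l2 d2; rewrite /restr; do 2 case: ifP => // _; exact: (tab_row T).
- move=> i j l1 d1 l2 d2; rewrite /restr; do 2 case: ifP => // _; exact: (tab_col T).
Qed.

End Analysis.

(** * Adding a new largest label to a tableau *)

Section Synthesis.
Variables (f g mu : nat -> nat) (l : 'I_n) (G : nat -> nat -> option ('I_n * 'I_4)).
Hypotheses (fd : decr f) (gd : decr g) (mug : forall i, mu i <= g i).
Hypothesis ok : forall i, gap_ok f g i.
Hypothesis T : tableau g mu l G.

Lemma glue_in i j : g i <= j < f i -> glue f g l G i j = Some (l, inord (dirn f g i j)).
Proof. by rewrite /glue => ->. Qed.

Lemma glue_cell i j l' d : glue f g l G i j = Some (l', d) ->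
  (g i <= j < f i) && (l' == l) && (val d == dirn f g i j) \/
  [/\ G i j = Some (l', d), (g i <= j < f i) = false, l' < l & mu i <= j < g i].
Proof.
rewrite /glue; case: ifP => H; first by case=> <- <-; left; rewrite eqxx val_dirn eqxx.
by move=> E; right; have [? ? _] := tab_cell T E.
Qed.

Lemma glue_out i j : mu i <= j < g i -> glue f g l G i j = G i j.
Proof. by rewrite /glue => H; case: ifP => //; lia. Qed.

Lemma gf_le i : g i <= f i.
Proof. by have := ok i; rewrite /gap_ok /seg_lo /seg_hi; case: i => [|i]; lia. Qed.

Lemma dir_partner i j : g i <= j < f i -> exists i2 j2,
  [/\ partner i j (dirn f g i j) = Some (i2, j2), g i2 <= j2 < f i2 &
      dirn f g i2 j2 = opp_dir (dirn f g i j)].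
Proof.
move=> H; rewrite {1 3}/dirn; case: (ltnP j (seg_lo f g i)) => L.
  exists i.+1, j; have C : j < f i.+1 by move: L H; rewrite /seg_lo; lia.
  have := (ok i.+1, gd i); rewrite /gap_ok /= => -[/andP [O1 _] O2].
  have := O1; rewrite leq_min => /andP [O3 O4].
  split=> //=; first by lia.
  rewrite /dirn; have -> : j < seg_lo f g i.+1 = false by lia.
  by have -> : seg_hi f g i.+1 <= j by rewrite /seg_hi; lia.
case: leqP => U.
  case: i H L U => [|i'] H L U; first by move: U; rewrite /seg_hi; lia.
  exists i', j; have := (fd i', ok i'.+1); rewrite /gap_ok => -[O1 /andP [O2 _]].
  have C : g i' <= j < f i' by move: U; rewrite /seg_hi; lia.
  by split=> //=; rewrite /dirn; case: ltnP => //; rewrite /seg_lo; lia.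
have := ok i; rewrite /gap_ok => /andP [O1 O2].
case O: (odd (j - seg_lo f g i)).
  have j0 : 0 < j by lia.
  exists i, j.-1; rewrite /= j0.
  have C : g i <= j.-1 < f i by move: L O; rewrite /seg_lo; lia.
  split=> //; rewrite /dirn.
  have -> : j.-1 < seg_lo f g i = false by lia.
  have -> : seg_hi f g i <= j.-1 = false by lia.
  by have -> : odd (j.-1 - seg_lo f g i) = false by lia.
exists i, j.+1.
have U' : j.+1 < seg_hi f g i by lia.
have C : g i <= j.+1 < f i by move: U' H; rewrite /seg_hi; case: (i); lia.
split=> //; rewrite /dirn.
have -> : j.+1 < seg_lo f g i = false by lia.
have -> : seg_hi f g i <= j.+1 = false by lia.
by have -> : odd (j.+1 - seg_lo f g i) by lia.
Qed.

Lemma glue_tableau : tableau f mu l.+1 (glue f g l G).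
Proof.
split.
- move=> i j l' d /glue_cell [/andP [/andP [H /eqP ->] /eqP dE]|[E H ll mj]].
    split; first exact: ltnSn; first by have := mug i; lia.
    have [i2 [j2 [P C O]]] := dir_partner H.
    exists i2, j2, (inord (dirn f g i2 j2)); split; rewrite ?dE //; first exact: glue_in.
    by rewrite val_dirn O.
  split; first exact: ltnW; first by have := gf_le i; lia.
  have [_ _ [i2 [j2 [d2 [P E2 O]]]]] := tab_cell T E.
  exists i2, j2, d2; split=> //; rewrite glue_out //; by have [] := tab_cell T E2.
- move=> i j /andP [mj jf]; case: (ltnP j (g i)) => H.
    have [|l' [d E]] := @tab_some _ _ _ _ T i j; first by rewrite mj.
    by exists l', d; rewrite glue_out // mj.
  by exists l, (inord (dirn f g i j)); rewrite glue_in // H.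
- move=> i j l1 d1 l2 d2 /glue_cell [/andP [/andP [H /eqP ->] _]|[E1 H1 ll1 m1]]
   /glue_cell [/andP [/andP [H' /eqP ->] _]|[E2 H2 ll2 m2]] //; first by lia.
    exact: ltnW.
  exact: (tab_row T E1 E2).
- move=> i j l1 d1 l2 d2 /glue_cell [/andP [/andP [H /eqP ->] dE]|[E1 H1 ll1 m1]]
   /glue_cell [/andP [/andP [H' /eqP ->] _]|[E2 H2 ll2 m2]].
  + by rewrite (eqP dE) /dirn; case: ifP => // /negP []; rewrite /seg_lo; lia.
  + by have := gd i; lia.
  + by rewrite ll1 orbT.
  + exact: (tab_col T E1 E2).
Qed.

Lemma glue_layer i j : (j < g i) = (j < mu i) || lt_lab l (glue f g l G i j).
Proof.
case: (ltnP j (mu i)) => H /=; first by have := mug i; lia.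
rewrite /glue; case: (ltnP j (g i)) => H2 /=.
  have [|l' [d E]] := @tab_some _ _ _ _ T i j; first by rewrite H.
  by rewrite E /=; have [] := tab_cell T E.
case: ifP => H3; first by rewrite /= ltnn.
case E: (G i j) => [[l' d]|] //; have [_ + _] := tab_cell T E; lia.
Qed.

Lemma restr_glue i j : restr l (glue f g l G) i j = G i j.
Proof.
rewrite /restr /glue; case H: (g i <= j < f i).
  rewrite /lt_lab ltnn; case E: (G i j) => [[l' d]|] //; have [_ + _] := tab_cell T E; lia.
by case E: (G i j) => [[l' d]|] //=; have [-> _ _] := tab_cell T E.
Qed.
End Synthesis.
End Layer.

Import GRing.Theory.
Local Open Scope ring_scope.

(** * Transfer matrices and their intertwiners *)

Lemma big_words (S : nmodType) n (f : seq bool -> S) :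
  \sum_(s <- words n.+1) f s =
  \sum_(s <- words n) f (true :: s) + \sum_(s <- words n) f (false :: s).
Proof. by rewrite big_cat !big_map. Qed.

Section Transfer.
Variable (S : comRingType) (t : S).

Definition strip (x : S) l r a a' : S :=
  if sexp l r a a' is Some (i, j) then x ^+ i * t ^+ j else 0.

Definition wt (x : S) (r l a a' : bool) : S :=
  if step_ok r l a then x ^+ nxt r l a * t ^+ (a' && (r || a)) else 0.

Lemma strip_cons x l0 l r0 r a a' :
  strip x (l0 :: l) (r0 :: r) a a' = wt x r0 l0 a a' * strip x l r a' (nxt r0 l0 a).
Proof.
rewrite /strip /wt /=; case: (step_ok _ _ _); last by rewrite mul0r.
case: (sexp _ _ _ _) => [[i j]|]; last by rewrite mulr0.
by rewrite !exprD mulrACA.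
Qed.

Definition Aup (y x : S) m n a a' d d' :=
  \sum_(l <- words (size m)) strip y l m a a' * strip x l n d d'.
Definition Bdn (y x : S) m n a a' d d' :=
  \sum_(k <- words (size m)) strip y n k a a' * strip x m k d d'.

Lemma Aup_cons y x m0 m n0 n a a' d d' :
  Aup y x (m0 :: m) (n0 :: n) a a' d d' =
  wt y m0 true a a' * wt x n0 true d d' * Aup y x m n a' (nxt m0 true a) d' (nxt n0 true d) +
  wt y m0 false a a' * wt x n0 false d d' * Aup y x m n a' (nxt m0 false a) d' (nxt n0 false d).
Proof.
rewrite /Aup /= big_words; congr (_ + _); rewrite mulr_sumr; apply: eq_bigr => l _;
by rewrite !strip_cons mulrACA.
Qed.

Lemma Bdn_cons y x m0 m n0 n a a' d d' :
  Bdn y x (m0 :: m) (n0 :: n) a a' d d' =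
  wt y true n0 a a' * wt x true m0 d d' * Bdn y x m n a' (nxt true n0 a) d' (nxt true m0 d) +
  wt y false n0 a a' * wt x false m0 d d' * Bdn y x m n a' (nxt false n0 a) d' (nxt false m0 d).
Proof.
rewrite /Bdn /= big_words; congr (_ + _); rewrite mulr_sumr; apply: eq_bigr => l _;
by rewrite !strip_cons mulrACA.
Qed.

(** The solution, unique up to a scalar, of the linear system expressing that the
    products of step weights in the two orders are intertwined. *)
Definition Rmx (z : S) (p s : bool * bool * bool * bool) : S :=
  let w := 1 - t ^+ 2 * z in
  match p, s with
  | (false,false,false,false), (false,false,false,false) => (1 - z) * w
  | (false,false,false,false), (false,true,false,true) => w
  | (false,false,false,false), (true,false,true,false) => w
  | (false,false,false,false), (true,true,true,true) => t ^+ 2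
  | (false,false,false,true), (false,false,false,true) => w
  | (false,false,false,true), (true,false,true,true) => t
  | (false,false,true,false), (false,false,true,false) => w
  | (false,false,true,false), (false,true,true,true) => t ^+ 2
  | (false,false,true,true), (false,false,true,true) => 1
  | (false,true,false,false), (false,true,false,false) => w
  | (false,true,false,false), (true,true,true,false) => t
  | (false,true,false,true), (false,false,false,false) => z * w
  | (false,true,false,true), (false,true,false,true) => - w
  | (false,true,false,true), (true,false,true,false) => t ^+ 2 * z
  | (false,true,false,true), (true,true,true,true) => - t ^+ 2
  | (false,true,true,false), (false,true,true,false) => t
  | (false,true,true,true), (false,false,true,false) => t * z
  | (false,true,true,true), (false,true,true,true) => - t
  | (true,false,false,false), (true,false,false,false) => w
  | (true,false,false,false), (true,true,false,true) => t ^+ 2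
  | (true,false,false,true), (true,false,false,true) => t
  | (true,false,true,false), (false,false,false,false) => z * w
  | (true,false,true,false), (false,true,false,true) => t ^+ 2 - w
  | (true,false,true,false), (true,false,true,false) => - w
  | (true,false,true,false), (true,true,true,true) => - t ^+ 2
  | (true,false,true,true), (false,false,false,true) => t ^+ 2 * z
  | (true,false,true,true), (true,false,true,true) => - t
  | (true,true,false,false), (true,true,false,false) => 1
  | (true,true,false,true), (true,false,false,false) => t * z
  | (true,true,false,true), (true,true,false,true) => - t
  | (true,true,true,false), (false,true,false,false) => t ^+ 2 * z
  | (true,true,true,false), (true,true,true,false) => - t
  | (true,true,true,true), (false,false,false,false) => t ^+ 2 * z ^+ 2
  | (true,true,true,true), (false,true,false,true) => - (t ^+ 2 * z)
  | (true,true,true,true), (true,false,true,false) => - (t ^+ 2 * z)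
  | (true,true,true,true), (true,true,true,true) => t ^+ 2
  | _, _ => 0
  end.

Definition sumb (f : bool -> S) : S := f true + f false.

(** The intertwiner makes this defect satisfy the recursion of [Aup], so that only
    the empty word has to be examined. *)
Definition Rerr (y x : S) m n a a' d d' : S :=
  sumb (fun p1 => sumb (fun p2 => sumb (fun p3 => sumb (fun p4 =>
    Bdn y x m n p1 p2 p3 p4 * Rmx (x * y) (p1, p2, p3, p4) (a, a', d, d')))))
  - (1 - x * y) * (1 - t ^+ 2 * (x * y)) * Aup y x m n a a' d d'.

Lemma Rerr_cons y x m0 m n0 n a a' d d' :
  Rerr y x (m0 :: m) (n0 :: n) a a' d d' =
  wt y m0 true a a' * wt x n0 true d d' * Rerr y x m n a' (nxt m0 true a) d' (nxt n0 true d) +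
  wt y m0 false a a' * wt x n0 false d d' * Rerr y x m n a' (nxt m0 false a) d' (nxt n0 false d).
Proof.
rewrite /Rerr /sumb Aup_cons !Bdn_cons /Rmx /wt.
(* The tails enter linearly, so they can be opaque functions; each of the 64 cases of bits is then a
   polynomial identity. *)
move: (Aup y x m n) (Bdn y x m n) => A B.
by case: m0; case: n0; case: a; case: a'; case: d; case: d'; rewrite /step_ok /nxt /=; ring.
Qed.

End Transfer.

Section Boundary.
Variables (S : comRingType) (t al be : S).

(** Multiplies [al] for each bead with an odd number of holes on its left and [be]
    for each hole with an odd number of beads on its right. *)
Fixpoint vword (l : seq bool) (h b : bool) : S :=
  match l with
  | [::] => if b then 0 else 1
  | true :: l' => al ^+ h * vword l' h (~~ b)
  | false :: l' => be ^+ b * vword l' (~~ h) b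
  end.

Definition vwt (l0 h b : bool) : S := if l0 then al ^+ h else be ^+ b.

(** [h] and [b] are the parities attached to [m]. A bead in transit has been read in the smaller
    word but not yet in the larger one, which changes the holes read and the beads to come by one;
    modulo 2 the same shift serves [Vup] and [Vdn]. *)
Definition Vup (x : S) m h b a a' :=
  \sum_(l <- words (size m)) vword l (h (+) a (+) a') (b (+) a (+) a') * strip t x l m a a'.
Definition Vdn (x : S) m h b d d' :=
  \sum_(k <- words (size m)) vword k (h (+) d (+) d') (b (+) d (+) d') * strip t x m k d d'.

Definition hnext (m0 h : bool) := if m0 then h else ~~ h.
Definition bnext (m0 b : bool) := if m0 then ~~ b else b.

Lemma vword_cons l0 l h b :
  vword (l0 :: l) h b = vwt l0 h b * vword l (hnext l0 h) (bnext l0 b).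
Proof. by case: l0. Qed.

Lemma parity_up m0 l0 h a a' : step_ok m0 l0 a ->
  (hnext l0 (h (+) a (+) a') = hnext m0 h (+) a' (+) nxt m0 l0 a) *
  (bnext l0 (h (+) a (+) a') = bnext m0 h (+) a' (+) nxt m0 l0 a).
Proof. by case: m0; case: l0; case: h; case: a; case: a'. Qed.

Lemma parity_dn m0 l0 h a a' : step_ok l0 m0 a ->
  (hnext l0 (h (+) a (+) a') = hnext m0 h (+) a' (+) nxt l0 m0 a) *
  (bnext l0 (h (+) a (+) a') = bnext m0 h (+) a' (+) nxt l0 m0 a).
Proof. by case: m0; case: l0; case: h; case: a; case: a'. Qed.

Lemma Vup_cons x m0 m h b a a' :
  Vup x (m0 :: m) h b a a' =
  vwt true (h (+) a (+) a') (b (+) a (+) a') * wt t x m0 true a a' *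
    Vup x m (hnext m0 h) (bnext m0 b) a' (nxt m0 true a) +
  vwt false (h (+) a (+) a') (b (+) a (+) a') * wt t x m0 false a a' *
    Vup x m (hnext m0 h) (bnext m0 b) a' (nxt m0 false a).
Proof.
rewrite /Vup /= big_words; congr (_ + _); rewrite mulr_sumr; apply: eq_bigr => l _;
rewrite strip_cons vword_cons mulrACA /wt.
- case: ifP => [/parity_up E|_]; last by rewrite mulr0 !mul0r.
  by rewrite !E.
- case: ifP => [/parity_up E|_]; last by rewrite mulr0 !mul0r.
  by rewrite !E.
Qed.

Lemma Vdn_cons x m0 m h b a a' :
  Vdn x (m0 :: m) h b a a' =
  vwt true (h (+) a (+) a') (b (+) a (+) a') * wt t x true m0 a a' *
    Vdn x m (hnext m0 h) (bnext m0 b) a' (nxt true m0 a) +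
  vwt false (h (+) a (+) a') (b (+) a (+) a') * wt t x false m0 a a' *
    Vdn x m (hnext m0 h) (bnext m0 b) a' (nxt false m0 a).
Proof.
rewrite /Vdn /= big_words; congr (_ + _); rewrite mulr_sumr; apply: eq_bigr => l _;
rewrite strip_cons vword_cons mulrACA /wt.
- case: ifP => [/parity_dn E|_]; last by rewrite mulr0 !mul0r.
  by rewrite !E.
- case: ifP => [/parity_dn E|_]; last by rewrite mulr0 !mul0r.
  by rewrite !E.
Qed.

(** Again the solution, unique up to a scalar, of a linear system; [h] and [b] are
    the parities of the number of holes to the left and of beads to the right.
    The factor [be ^+ 2] in [Kden] clears its denominators. *)
Definition Kmx (x : S) (h b : bool) (p s : bool * bool) : S :=
  let u := 1 - x ^+ 2 * t ^+ 2 in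
  let v := if h then al ^+ 2 + x * t else 1 + x * t * al ^+ 2 in
  let v' := if h then 1 + x * t * al ^+ 2 else al ^+ 2 + x * t in
  let ah := al ^+ h in let ah' := al ^+ (~~ h) in
  let bb := be ^+ b in let bb' := be ^+ (~~ b) in
  match p, s with
  | (false,false), (false,false) => u * bb' ^+ 2 * (if b then be ^+ 2 - x else 1 - x * be ^+ 2)
  | (false,false), (false,true) => u * bb' ^+ 3 * ah
  | (false,false), (true,false) => u * bb' ^+ 2 * bb * ah'
  | (false,false), (true,true) => t * v * bb' ^+ 2
  | (false,true), (false,false) => u * x * bb' ^+ 2 * bb * ah'
  | (false,true), (false,true) => - (u * al * be)
  | (false,true), (true,false) => x * t * v * bb ^+ 2
  | (false,true), (true,true) => - (t * v * ah' * bb)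
  | (true,false), (false,false) => u * x * bb' ^+ 3 * ah
  | (true,false), (false,true) =>
      t * v' * bb ^+ 2 - u * ah ^+ 2 * bb' ^+ 2
  | (true,false), (true,false) => - (u * al * be)
  | (true,false), (true,true) => - (t * v * ah * bb')
  | (true,true), (false,false) => x ^+ 2 * t * v * bb' ^+ 2
  | (true,true), (false,true) => - (x * t * v * ah * bb')
  | (true,true), (true,false) => - (x * t * v * ah' * bb)
  | (true,true), (true,true) => t * v * ah' ^+ 2
  end.

Definition Kden (x : S) := be ^+ 2 * ((1 - be ^+ 2 * x) * (1 - t ^+ 2 * x ^+ 2)).

Definition Kerr (x : S) m h b a a' : S :=
  sumb (fun p1 => sumb (fun p2 => Vdn x m h b p1 p2 * Kmx x h b (p1, p2) (a, a')))
  - Kden x * Vup x m h b a a'.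

Lemma Kerr_cons x m0 m h b a a' :
  Kerr x (m0 :: m) h b a a' =
  vwt true (h (+) a (+) a') (b (+) a (+) a') * wt t x m0 true a a' *
    Kerr x m (hnext m0 h) (bnext m0 b) a' (nxt m0 true a) +
  vwt false (h (+) a (+) a') (b (+) a (+) a') * wt t x m0 false a a' *
    Kerr x m (hnext m0 h) (bnext m0 b) a' (nxt m0 false a).
Proof.
rewrite /Kerr /sumb Vup_cons !Vdn_cons /Kmx /wt /vwt /Kden.
move: (Vup x m) (Vdn x m) => A B.
by case: m0; case: h; case: b; case: a; case: a'; rewrite /step_ok /nxt /=; ring.
Qed.

End Boundary.

(** * Local Cauchy and Littlewood identities *)

Section Order.
Variables (R : comRingType) (n : nat).
Implicit Types p q : {mpoly R[n]}.

Definition ordge (k : nat) p := forall m : 'X_{1..n}, (mdeg m < k)%N -> p@_m = 0.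

Lemma ordge0 p : ordge 0 p. Proof. by []. Qed.
Lemma ordge_zero k : ordge k (0 : {mpoly R[n]}). Proof. by move=> m _; rewrite mcoeff0. Qed.
Lemma ordgeW j k p : (j <= k)%N -> ordge k p -> ordge j p.
Proof. by move=> jk H m Hm; apply: H; apply: leq_trans jk. Qed.
Lemma ordgeD k p q : ordge k p -> ordge k q -> ordge k (p + q).
Proof. by move=> Hp Hq m Hm; rewrite mcoeffD Hp // Hq // addr0. Qed.
Lemma ordgeN k p : ordge k p -> ordge k (- p).
Proof. by move=> Hp m Hm; rewrite mcoeffN Hp // oppr0. Qed.
Lemma ordgeB k p q : ordge k p -> ordge k q -> ordge k (p - q).
Proof. by move=> Hp Hq; apply/ordgeD/ordgeN. Qed.
Lemma ordge_sum k (I : Type) (r : seq I) (P : pred I) (F : I -> {mpoly R[n]}) :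
  (forall i, P i -> ordge k (F i)) -> ordge k (\sum_(i <- r | P i) F i).
Proof. by move=> H; elim/big_ind: _ => //; [exact: ordge_zero | exact: ordgeD]. Qed.

Lemma ordgeM j k p q : ordge j p -> ordge k q -> ordge (j + k) (p * q).
Proof.
move=> Hp Hq m Hm; rewrite mcoeffM big1 // => -[[k1 H1] [k2 H2]] /= /eqP E.
have: (mdeg k1 + mdeg k2 < j + k)%N by rewrite -mdegD -E.
case: (ltnP (mdeg k1) j) => [/Hp -> _|jk]; first by rewrite mul0r.
by move=> L; rewrite Hq ?mulr0 //; lia.
Qed.

Lemma ordgeMl k p q : ordge k q -> ordge k (p * q).
Proof. by move=> Hq; apply: (@ordgeM 0 k _ _ _ Hq); apply: ordge0. Qed.

Lemma ordgeX k p : ordge 1 p -> ordge k (p ^+ k).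
Proof.
move=> Hp; elim: k => [|k IH]; first exact: ordge0.
by rewrite exprS -addn1 addnC; apply: ordgeM.
Qed.

Variables (t : {mpoly R[n]}).

Lemma ordge_wt x r l a a' : ordge 1 x -> ordge (nxt r l a) (wt t x r l a a').
Proof.
move=> Hx; rewrite /wt; case: ifP => _; last exact: ordge_zero.
by rewrite mulrC; apply/ordgeMl/ordgeX.
Qed.

Section Pair.
Variables (x y : {mpoly R[n]}).
Hypotheses (Hx : ordge 1 x) (Hy : ordge 1 y).

Lemma Rerr_zeros0 z : Rerr t y x (nseq z false) (nseq z false) false false false false = 0.
Proof.
elim: z => [|z IH] /=; last by rewrite Rerr_cons /nxt /= IH /wt /step_ok /= !mulr0 ?mul0r add0r.
rewrite /Rerr /sumb /Rmx /Aup /Bdn /= !big_seq1 /strip /=; ring.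
Qed.

(** During two holes every bead in transit arrives. Either all of them stop, and the defect vanishes
    by [Rerr_zeros0], or one moves on and contributes a factor [x] or [y]. *)
Lemma Rerr_zeros k a a' d d' :
  ordge k (Rerr t y x (nseq k.*2 false) (nseq k.*2 false) a a' d d').
Proof.
elim: k a a' d d' => [|k IH] a a' d d'; first exact: ordge0.
have key l l2 : ordge k.+1
    (wt t y false l a a' * wt t x false l d d' *
    (wt t y false l2 a' (nxt false l a) * wt t x false l2 d' (nxt false l d) *
     Rerr t y x (nseq k.*2 false) (nseq k.*2 false)
       (nxt false l a) (nxt false l2 a') (nxt false l d) (nxt false l2 d'))).
  have [w1 w2] := (ordge_wt (r:=false) (l:=l) (a:=a) a' Hy, ordge_wt (r:=false) (l:=l) (a:=d) d' Hx).
  have [w3 w4] := (ordge_wt (r:=false) (l:=l2) (a:=a') (nxt false l a) Hy,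
                   ordge_wt (r:=false) (l:=l2) (a:=d') (nxt false l d) Hx).
  have := ordgeM (ordgeM w1 w2) (ordgeM (ordgeM w3 w4) (IH (nxt false l a) (nxt false l2 a') (nxt false l d) (nxt false l2 d'))).
  case: (nxt false l a); case: (nxt false l d); case: (nxt false l2 a'); case: (nxt false l2 d');
    try (by apply: ordgeW; lia).
  by move=> _; rewrite Rerr_zeros0 !mulr0; apply: ordge_zero.
rewrite doubleS [nseq _ _]/= Rerr_cons.
by apply: ordgeD; rewrite Rerr_cons mulrDr; apply: ordgeD; exact: key.
Qed.

Lemma Rerr_ordge k m n' a a' d d' : size m = size n' ->
  ordge k (Rerr t y x (m ++ nseq k.*2 false) (n' ++ nseq k.*2 false) a a' d d').
Proof.
elim: m n' a a' d d' => [|m0 m IH] [|n0 n'] // a a' d d'; first by move=> _; apply: Rerr_zeros.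
by case=> E; rewrite /= Rerr_cons; apply: ordgeD; apply/ordgeMl/IH.
Qed.

(** A leading bead of a larger word either was there before or arrived from outside, so a common
    smaller word forces both sweeps to have the same arrivals. With z = x y and w = 1 - t^2 z, the
    four surviving terms (1 - z) w, t^2 z w, z w and t^4 z^2 sum to 1. *)
Lemma Bdn_ones m n' :
  sumb (fun s1 => sumb (fun s2 => sumb (fun s3 => sumb (fun s4 =>
    Bdn t y x (true :: true :: m) (true :: true :: n') s1 s2 s3 s4 *
    Rmx t (x * y) (s1, s2, s3, s4) (false, false, false, false)))))
  = Bdn t y x (true :: true :: m) (true :: true :: n') false false false false.
Proof.
rewrite /sumb !Bdn_cons /Rmx /wt /step_ok /nxt /=.
move: (Bdn t y x m n') => B; ring.
Qed.

Lemma cauchy_local k m n' : size m = size n' ->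
  let m1 := [:: true, true & m ++ nseq k.*2 false] in
  let n1 := [:: true, true & n' ++ nseq k.*2 false] in
  ordge k ((1 - x * y) * (1 - t ^+ 2 * (x * y)) * Aup t y x m1 n1 false false false false
        - Bdn t y x m1 n1 false false false false).
Proof.
move=> E m1 n1; rewrite -opprB; apply: ordgeN.
have := @Rerr_ordge k (true :: true :: m) (true :: true :: n') false false false false.
by rewrite /= E => /(_ erefl); rewrite /Rerr Bdn_ones.
Qed.
End Pair.

Section One.
Variables (al be x : {mpoly R[n]}).
Hypothesis Hx : ordge 1 x.
Local Notation Kerr := (Kerr t al be x).

Lemma Kerr_zeros0 z h b : Kerr (nseq z false) h b false false = 0.
Proof.
elim: z h => [|z IH] h /=.
  rewrite /Kerr /sumb /Kmx /Vup /Vdn /Kden /= !big_seq1 /strip /=; case: b; case: h => /=; ring.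
by rewrite Kerr_cons /nxt /= IH /wt /step_ok /= !mulr0 ?mul0r add0r.
Qed.

Lemma Kerr_zeros k h b a a' : ordge k (Kerr (nseq k.*2 false) h b a a').
Proof.
elim: k h b a a' => [|k IH] h b a a'; first exact: ordge0.
have key l l2 u u' : ordge k.+1
    (u * wt t x false l a a' *
    (u' * wt t x false l2 a' (nxt false l a) *
     Kerr (nseq k.*2 false) (~~ ~~ h) b (nxt false l a) (nxt false l2 a'))).
  have w1 := ordge_wt (r:=false) (l:=l) (a:=a) a' Hx.
  have w3 := ordge_wt (r:=false) (l:=l2) (a:=a') (nxt false l a) Hx.
  have := ordgeM (@ordgeMl _ u _ w1) (ordgeM (@ordgeMl _ u' _ w3) (IH (~~ ~~ h) b (nxt false l a) (nxt false l2 a'))).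
  case: (nxt false l a); case: (nxt false l2 a'); try (by apply: ordgeW; lia).
  by move=> _; rewrite Kerr_zeros0 !mulr0; apply: ordge_zero.
rewrite doubleS [nseq _ _]/= Kerr_cons.
by apply: ordgeD; rewrite Kerr_cons mulrDr; apply: ordgeD; exact: key.
Qed.

Lemma Kerr_ordge k m h b a a' : ordge k (Kerr (m ++ nseq k.*2 false) h b a a').
Proof.
elim: m h b a a' => [|m0 m IH] h b a a'; first exact: Kerr_zeros.
by rewrite /= Kerr_cons; apply: ordgeD; apply/ordgeMl/IH.
Qed.

(** With u = 1 - t^2 x^2 and v = 1 + al^2 t x, the four choices of arrivals give, after division by
    be^2, u (1 - be^2 x), u al^2 t x, u be^2 x and t^2 x^2 v; their sum is u v + (1 - u) v = v. *)
Lemma Vdn_ones m :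
  sumb (fun s1 => sumb (fun s2 => Vdn t al be x (true :: true :: m) false false s1 s2 *
      Kmx t al be x false false (s1, s2) (false, false)))
  = be ^+ 2 * (1 + al ^+ 2 * t * x) * Vdn t al be x (true :: true :: m) false false false false.
Proof.
rewrite /sumb !Vdn_cons /Kmx /wt /vwt /step_ok /nxt /=.
move: (Vdn t al be x m) => B; ring.
Qed.

Lemma littlewood_local k m :
  let m1 := [:: true, true & m ++ nseq k.*2 false] in
  ordge k (be ^+ 2 * ((1 - be ^+ 2 * x) * (1 - t ^+ 2 * x ^+ 2) * Vup t al be x m1 false false false false
        - (1 + al ^+ 2 * t * x) * Vdn t al be x m1 false false false false)).
Proof.
move=> m1.
have := @Kerr_ordge k (true :: true :: m) false false false false.
rewrite /Kerr Vdn_ones -/m1 /Kden.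
move: (Vup _ _ _ _ _ _ _ _ _) (Vdn _ _ _ _ _ _ _ _ _) => A B /ordgeN H.
rewrite [X in ordge k X](_ : _ = - (be ^+ 2 * (1 + al ^+ 2 * t * x) * B
  - be ^+ 2 * ((1 - be ^+ 2 * x) * (1 - t ^+ 2 * x ^+ 2)) * A)) //; ring.
Qed.
End One.
End Order.

(** * Path sums *)

Section Global.
Variables (R : comRingType) (n N W : nat).
Local Notation S := {mpoly R[n]}.
Variables (t al be : S) (x : nat -> S) (s0 : seq bool).

Fixpoint paths (k : nat) (s : seq bool) : S :=
  if k is k'.+1 then \sum_(r <- words W) strip t (x k') s r false false * paths k' r
  else (s == s0)%:R.

Hypothesis Hx : forall k, ordge 1 (x k).
Local Notation strip := (strip t).

Lemma strip_neq0P (y : S) l r : strip y l r false false = 0 \/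
  exists e, sexp l r false false = Some e.
Proof. by rewrite /strip; case: (sexp _ _ _ _) => [e|]; [right; exists e | left]. Qed.

Lemma strip_ordge y l r : ordge 1 y ->
  ordge ((possum l 0 - possum r 0)./2) (strip y l r false false).
Proof.
move=> Hy; rewrite /strip; case E: (sexp _ _ _ _) => [[i j]|]; last exact: ordge_zero.
have := sexp_possum 0 E; rewrite !mul0n !addn0 => ->.
by rewrite addKn doubleK mulrC; apply/ordgeMl/ordgeX.
Qed.

Lemma paths_ordge k s : ordge (uphalf (possum s 0 - possum s0 0)) (paths k s).
Proof.
elim: k s => [|k IH] s /=.
  case: eqP => [->|_]; last exact: ordge_zero.
  by rewrite subnn; apply: ordge0.
apply: ordge_sum => r _; case: (strip_neq0P (x k) s r) => [->|[[i j] /(sexp_possum 0)]].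
  by rewrite mul0r; apply: ordge_zero.
rewrite !mul0n !addn0 => E.
apply: ordgeW (ordgeM (strip_ordge (Hx k)) (IH r)).
rewrite E addKn doubleK; lia.
Qed.

Lemma paths_count k s : count id s != count id s0 -> paths k s = 0.
Proof.
elim: k s => [|k IH] s /= H; first by case: (s =P s0) H => [->|_ _]; rewrite ?eqxx.
apply: big1 => r _; case: (strip_neq0P (x k) s r) => [->|[e /sexp_count]]; first by rewrite mul0r.
by rewrite !addn0 => E; rewrite IH ?mulr0 // -E.
Qed.

Lemma paths_oddbeads k s : oddbeads s false != oddbeads s0 false -> paths k s = 0.
Proof.
elim: k s => [|k IH] s /= H; first by case: (s =P s0) H => [->|_ _]; rewrite ?eqxx.
apply: big1 => r _; case: (strip_neq0P (x k) s r) => [->|[e /(sexp_oddbeads false)]]; first by rewrite mul0r.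
by rewrite /= !addn0 => E; rewrite IH ?mulr0 // -E.
Qed.

(** The form of word to which [cauchy_local] and [littlewood_local] apply with order [N.+1]. *)
Definition padded (s : seq bool) :=
  exists m, s = [:: true, true & m ++ nseq N.+1.*2 false].

Hypothesis s0W : size s0 = W.
Hypothesis Hpadded : forall s, size s = W -> count id s = count id s0 ->
  (possum s 0 <= possum s0 0 + N.*2)%N -> padded s.
Hypothesis Hcore : forall s, size s = W ->
  sexp s0 s false false = if s == s0 then Some (0, 0)%N else None.

Definition fc (y z : S) := (1 - y * z) * (1 - t ^+ 2 * (y * z)).
Definition Gprod k y := \prod_(i < k) fc y (x i).
Definition Ddown k y s := \sum_(l <- words W) strip y l s false false * paths k l.

Definition eq_upto (p q : S) := ordge N.+1 (p - q).

Lemma eq_upto_refl p : eq_upto p p. Proof. by rewrite /eq_upto subrr; apply: ordge_zero. Qed.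
Lemma eq_upto_trans p q r : eq_upto p q -> eq_upto q r -> eq_upto p r.
Proof. by move=> H1 H2; rewrite /eq_upto -(subrKA q); apply: ordgeD. Qed.
Lemma eq_upto_sym p q : eq_upto p q -> eq_upto q p.
Proof. by move=> H; rewrite /eq_upto -opprB; apply: ordgeN. Qed.
Lemma eq_upto_mull r p q : eq_upto p q -> eq_upto (r * p) (r * q).
Proof. by move=> H; rewrite /eq_upto -mulrBr; apply: ordgeMl. Qed.
Lemma eq_upto_sum (I : eqType) (s : seq I) (f g : I -> S) :
  (forall i, i \in s -> eq_upto (f i) (g i)) -> eq_upto (\sum_(i <- s) f i) (\sum_(i <- s) g i).
Proof. by move=> H; rewrite /eq_upto -sumrB big_seq; apply: ordge_sum => i; apply: H. Qed.

Lemma paths_padded k s : size s = W -> ordge N.+1 (paths k s) \/ (padded s /\ count id s = count id s0).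
Proof.
move=> sW; case: (eqVneq (count id s) (count id s0)) => [E|/paths_count ->]; last by left; apply: ordge_zero.
case: (leqP (possum s 0) (possum s0 0 + N.*2)) => H; first by right; split=> //; apply: Hpadded.
left; apply: ordgeW (@paths_ordge k s); lia.
Qed.

(** The added strip is moved through the [k] strips of the path, at the price of one factor [fc]
    each. At the bottom it would have to be removed from the core, which only the empty strip
    allows. The bound on [possum] guarantees that [s] is padded, and it is inherited by smaller
    words. *)
Lemma Ddown_paths k y s : ordge 1 y -> size s = W -> count id s = count id s0 ->
  (possum s 0 <= possum s0 0 + N.*2)%N -> eq_upto (Gprod k y * Ddown k y s) (paths k s).
Proof.
move=> Hy; elim: k s => [|k IH] s sW sc sp.
  rewrite /Gprod big_ord0 mul1r /Ddown /= (bigD1_seq s0) ?words_uniq ?mem_words ?s0W //=.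
  rewrite eqxx mulr1 big1 ?addr0; last by move=> i /negbTE ->; rewrite mulr0.
  by rewrite /strip Hcore // ; case: eqP => _; rewrite ?expr0 ?mul1r; apply: eq_upto_refl.
have -> : Gprod k.+1 y * Ddown k.+1 y s = Gprod k y *
    \sum_(m <- words W) paths k m * (fc y (x k) * Aup t (x k) y m s false false false false).
  rewrite /Gprod big_ord_recr /= -mulrA; congr (_ * _).
  rewrite /Ddown /= mulr_sumr (eq_bigr (fun l => \sum_(m <- words W)
    paths k m * (fc y (x k) * (strip (x k) l m false false * strip y l s false false)))).
    rewrite exchange_big /= big_seq [RHS]big_seq; apply: eq_bigr => m.
    by rewrite mem_words /Aup => /eqP ->; rewrite !mulr_sumr.
  by move=> l _; rewrite !mulr_sumr; apply: eq_bigr => m _; ring.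
apply: (@eq_upto_trans _ (Gprod k y *
    \sum_(m <- words W) paths k m * Bdn t (x k) y m s false false false false)).
  apply/eq_upto_mull/eq_upto_sum => m; rewrite mem_words => /eqP mW.
  case: (paths_padded k mW) => [H|[[m' Em] _]].
    by rewrite /eq_upto -mulrBr mulrC; apply: ordgeMl.
  apply: eq_upto_mull; have [s' Es] := Hpadded sW sc sp.
  rewrite Es Em; apply: cauchy_local => //.
  by move: sW mW; rewrite Es Em /= !size_cat => <-; lia.
have -> : Gprod k y * (\sum_(m <- words W) paths k m * Bdn t (x k) y m s false false false false)
  = \sum_(r <- words W) strip (x k) s r false false * (Gprod k y * Ddown k y r).
  rewrite mulr_sumr (eq_big_seq (fun m => \sum_(r <- words W)
    strip (x k) s r false false * (Gprod k y * (strip y m r false false * paths k m)))).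
    by rewrite exchange_big /=; apply: eq_bigr => r _; rewrite /Ddown !mulr_sumr.
  move=> m; rewrite mem_words /Bdn => /eqP ->; rewrite !mulr_sumr; apply: eq_bigr => r _; ring.
apply: eq_upto_sum => r; rewrite mem_words => /eqP rW.
case: (strip_neq0P (x k) s r) => [->|[[i j] E]]; first by rewrite !mul0r; apply: eq_upto_refl.
apply: eq_upto_mull; apply: IH => //; first by have := sexp_count E; rewrite !addn0 => <-.
by have := sexp_possum 0 E; lia.
Qed.

Definition Vsum k := \sum_(s <- words W) vword al be s false false * paths k s.

Hypothesis Hbe : forall k p, ordge k (be * p) -> ordge k p.

(** The local Littlewood identity trades the sum over words above [m] for a sum over words [r] below
    it. The strip from [r] up to [m] is then absorbed by [Ddown_paths]. *)
Lemma Vsum_step k :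
  eq_upto ((1 - be ^+ 2 * x k) * (1 - t ^+ 2 * x k ^+ 2) * Gprod k (x k) * Vsum k.+1)
      ((1 + al ^+ 2 * t * x k) * Vsum k).
Proof.
set den := (1 - _) * _; set num := 1 + _.
have -> : den * Gprod k (x k) * Vsum k.+1 =
   Gprod k (x k) * \sum_(m <- words W) paths k m * (den * Vup t al be (x k) m false false false false).
  rewrite [den * _]mulrC -mulrA; congr (_ * _).
  rewrite /Vsum /= mulr_sumr (eq_bigr (fun l => \sum_(m <- words W)
    paths k m * (den * (vword al be l false false * strip (x k) l m false false)))).
    rewrite exchange_big /= big_seq [RHS]big_seq; apply: eq_bigr => m.
    by rewrite mem_words /Vup => /eqP ->; rewrite !mulr_sumr.
  by move=> l _; rewrite !mulr_sumr; apply: eq_bigr => m _; ring.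
apply: (@eq_upto_trans _ (Gprod k (x k) *
    \sum_(m <- words W) paths k m * (num * Vdn t al be (x k) m false false false false))).
  apply/eq_upto_mull/eq_upto_sum => m; rewrite mem_words => /eqP mW.
  case: (paths_padded k mW) => [H|[[m' Em] _]].
    by rewrite /eq_upto -mulrBr mulrC; apply: ordgeMl.
  (* [be] is cancelled twice, against the factor [be ^+ 2] in [littlewood_local]. *)
  apply: eq_upto_mull; rewrite Em /eq_upto; apply/Hbe/Hbe; rewrite mulrA -expr2.
  exact: littlewood_local.
have -> : Gprod k (x k) *
    (\sum_(m <- words W) paths k m * (num * Vdn t al be (x k) m false false false false))
  = num * \sum_(r <- words W) vword al be r false false * (Gprod k (x k) * Ddown k (x k) r).
  rewrite !mulr_sumr (eq_big_seq (fun m => \sum_(r <- words W)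
    num * (vword al be r false false * (Gprod k (x k) * (strip (x k) m r false false * paths k m))))).
    by rewrite exchange_big /=; apply: eq_bigr => r _; rewrite /Ddown !mulr_sumr.
  move=> m; rewrite mem_words /Vdn => /eqP ->; rewrite !mulr_sumr; apply: eq_bigr => r _.
  rewrite /=; ring.
apply/eq_upto_mull/eq_upto_sum => r; rewrite mem_words => /eqP rW; apply: eq_upto_mull.
case: (eqVneq (count id r) (count id s0)) => [rc|rc].
  case: (leqP (possum r 0) (possum s0 0 + N.*2)) => rp; first exact: Ddown_paths.
  (* Beyond the range of [Ddown_paths] both sides consist of terms of degree above [N]. *)
  apply: ordgeB; last by apply: ordgeW (@paths_ordge k r); lia.
  apply/ordgeMl/ordge_sum => l _; case: (strip_neq0P (x k) l r) => [->|[[i j] /(sexp_possum 0)]].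
    by rewrite mul0r; apply: ordge_zero.
  by move=> E; apply/ordgeMl; apply: ordgeW (@paths_ordge k l); lia.
rewrite paths_count // /Ddown big1 ?mulr0; first exact: eq_upto_refl.
move=> l _; case: (strip_neq0P (x k) l r) => [->|[e /sexp_count]]; first by rewrite mul0r.
by rewrite !addn0 => E; rewrite paths_count ?mulr0 // E.
Qed.

Lemma Vsum_total k :
  eq_upto (\prod_(i < k) ((1 - be ^+ 2 * x i) * (1 - t ^+ 2 * x i ^+ 2) * Gprod i (x i)) * Vsum k)
      (\prod_(i < k) (1 + al ^+ 2 * t * x i) * vword al be s0 false false).
Proof.
elim: k => [|k IH].
  rewrite !big_ord0 !mul1r /Vsum (bigD1_seq s0) ?words_uniq ?mem_words ?s0W //=.
  rewrite eqxx mulr1 big1 ?addr0; first exact: eq_upto_refl.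
  by move=> s /negbTE ->; rewrite mulr0.
rewrite !big_ord_recr /= -[X in eq_upto X]mulrA.
apply: eq_upto_trans (eq_upto_mull _ (Vsum_step k)) _.
by rewrite mulrCA [X in eq_upto _ X]mulrAC [X in eq_upto _ X]mulrC; apply: eq_upto_mull.
Qed.

End Global.

(** * Tableaux as path sums *)

Lemma find_downclosed (P : pred nat) M : (forall j, P j.+1 -> P j) -> (forall j, P j -> (j < M)%N) ->
  forall j, (j < find (predC P) (iota 0 M))%N = P j.
Proof.
move=> Pd PM j.
have Ple i : (i <= j)%N -> P j -> P i.
  by move=> ij; rewrite -(subnK ij); elim: (j - i)%N => // d IH; rewrite addSn => /Pd.
apply/idP/idP => [L|Pj].
  have := before_find 0%N L; rewrite nth_iota /=; first by move/negbFE.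
  by apply: leq_trans L _; rewrite -[X in (_ <= X)%N](size_iota 0 M) find_size.
rewrite ltnNge; apply/negP => L.
have LM : (find (predC P) (iota 0 M) < M)%N by apply: leq_ltn_trans L (PM _ Pj).
have := nth_find 0%N (s := iota 0 M) (a := predC P).
by rewrite has_find size_iota LM nth_iota // => /(_ isT) /=; rewrite add0n (Ple _ L Pj).
Qed.

Lemma prod_ord_resize (S : comNzRingType) (F : nat -> S) K M :
  (forall i, (K <= i)%N || (M <= i)%N -> F i = 1) -> \prod_(i < K) F i = \prod_(i < M) F i.
Proof.
move=> H; rewrite -!(big_mkord xpredT F).
wlog KM : K M H / (K <= M)%N.
  case: (leqP K M) => [KM /(_ K M H KM) //|/ltnW MK /(_ M K)].
  by move=> -> // i; rewrite orbC; apply: H.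
rewrite (big_cat_nat (n := K) (p := M)) //= [X in _ * X]big_nat_cond.
by rewrite [X in _ * X]big1 ?mulr1 // => i /andP [/andP [ki _] _]; rewrite H // ki.
Qed.

Lemma prod_alternating (S : comNzRingType) (x : S) a m :
  \prod_(a <= j < a + m.*2) (if odd (j - a) then 1 else x) = x ^+ m.
Proof.
elim: m => [|m IH]; first by rewrite addn0 big_geq.
rewrite doubleS !addnS !big_nat_recr ?leq_addr //=; last by rewrite leqW // leq_addr.
rewrite IH addKn odd_double.
have -> : odd ((a + m.*2).+1 - a) by lia.
by rewrite mulr1 exprSr.
Qed.

Section TabSum.
Variables (R : comRingType) (n M : nat) (t : R) (mu : nat -> nat).
Local Notation S := {mpoly R[n]}.
Local Notation fillT := {ffun 'I_M * 'I_M -> option ('I_n * 'I_4)}.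

Definition getT (T : fillT) (i j : nat) : option ('I_n * 'I_4) :=
  match insub i, insub j with
  | Some i', Some j' => T (i', j')
  | _, _ => None
  end.

Definition toT (G : nat -> nat -> option ('I_n * 'I_4)) : fillT :=
  [ffun c => G (val c.1) (val c.2)].

Definition bounded (f : nat -> nat) := forall i j, (j < f i)%N -> (i < M)%N /\ (j < M)%N.

Lemma getT_ord T (i j : 'I_M) : getT T i j = T (i, j).
Proof. by rewrite /getT !valK. Qed.

Lemma getT_out T i j : ~~ ((i < M) && (j < M))%N -> getT T i j = None.
Proof.
rewrite /getT; case: insubP => // u iM _; case: insubP => // v jM _.
by rewrite iM jM.
Qed.

Lemma toTK T : toT (getT T) = T.
Proof. by apply/ffunP => -[i j]; rewrite ffunE getT_ord. Qed.

Lemma getTK G i j : (forall i j, G i j <> None -> (i < M)%N /\ (j < M)%N) ->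
  getT (toT G) i j = G i j.
Proof.
move=> H; case: (boolP ((i < M) && (j < M))%N) => [/andP [iM jM]|out].
  by rewrite (getT_ord _ (Ordinal iM) (Ordinal jM)) ffunE.
rewrite getT_out //; case E: (G i j) => [c|] //.
have [|iM jM] := H i j; first by rewrite E.
by rewrite iM jM in out.
Qed.

Definition cellb (f : nat -> nat) (G : nat -> nat -> option ('I_n * 'I_4)) i j : bool :=
  let sk i j := ((j < f i) && ~~ (j < mu i))%N in
  match G i j with
  | None => ~~ sk i j
  | Some (l, d) =>
      sk i j &&
      match partner i j d with
      | None => false
      | Some (i2, j2) =>
          sk i2 j2 &&
          match G i2 j2 with
          | None => false
          | Some (l2, d2) => (l2 == l) && (val d2 == opp_dir d)
          end
      end
  end.

Definition rowb (G : nat -> nat -> option ('I_n * 'I_4)) i j : bool :=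
  match G i j, G i j.+1 with
  | Some (l1, _), Some (l2, _) => (val l1 <= val l2)%N
  | _, _ => true
  end.

Definition colb (G : nat -> nat -> option ('I_n * 'I_4)) i j : bool :=
  match G i j, G i.+1 j with
  | Some (l1, d1), Some (l2, _) => (val d1 == 2%N) || (val l1 < val l2)%N
  | _, _ => true
  end.

Definition labb (k : nat) (G : nat -> nat -> option ('I_n * 'I_4)) i j : bool :=
  if G i j is Some (l, _) then (l < k)%N else true.

Definition tabb (f : nat -> nat) k (T : fillT) : bool :=
  [forall i : 'I_M, mu i <= f i]%N &&
  [forall c : 'I_M * 'I_M, [&& cellb f (getT T) c.1 c.2, rowb (getT T) c.1 c.2,
     colb (getT T) c.1 c.2 & labb k (getT T) c.1 c.2]].

Hypothesis mu_bounded : bounded mu.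

Lemma tabbP f k T : bounded f ->
  reflect ((forall i, mu i <= f i)%N /\ tableau f mu k (getT T)) (tabb f k T).
Proof.
move=> bf; apply: (iffP andP) => -[H1 H2].
  split.
    move=> i; case: (ltnP i M) => iM; first by have /forallP /(_ (Ordinal iM)) := H1.
    by case E: (mu i) => [|j] //; have [] := @mu_bounded i j; rewrite ?E // ltnNge iM.
  have K i j : [&& cellb f (getT T) i j, rowb (getT T) i j, colb (getT T) i j & labb k (getT T) i j].
    case: (boolP ((i < M) && (j < M))%N) => [/andP [iM jM]|out].
      by have /forallP /(_ (Ordinal iM, Ordinal jM)) := H2.
    rewrite /cellb /rowb /colb /labb getT_out //= andbT negb_and.
    by rewrite -implybE; apply/implyP => /bf [iM jM]; rewrite iM jM in out.
  split.
  - move=> i j l d E; have /and4P [c1 _ _ lk] := K i j; move: c1 lk; rewrite /cellb /labb E => + lk.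
    case/andP => /andP [jf jm]; case P: (partner i j d) => [[i2 j2]|] // /andP [_].
    case E2: (getT _ _ _) => [[l2 d2]|] // /andP [/eqP ll /eqP O].
    rewrite ll in E2; split; [exact: lk | by rewrite leqNgt jm jf | by exists i2, j2, d2].
  - move=> i j /andP [jm jf]; have /and4P [+ _ _ _] := K i j; rewrite /cellb.
    case: (getT _ _ _) => [[l d]|] //=; first by exists l, d.
    by rewrite jf -leqNgt jm.
  - by move=> i j l1 d1 l2 d2 E1 E2; have /and4P [_ + _ _] := K i j; rewrite /rowb E1 E2.
  - by move=> i j l1 d1 l2 d2 E1 E2; have /and4P [_ _ + _] := K i j; rewrite /colb E1 E2.
split; first by apply/forallP => i; apply: H1.
apply/forallP => -[i j] /=; apply/and4P; split.
- rewrite /cellb; case E: (getT T i j) => [[l d]|]; last first.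
    rewrite -leqNgt; apply/negP => /andP [jf jm].
    by have [|l [d]] := tab_some H2 (i := i) (j := j); rewrite ?jf ?jm ?E.
  have [lk /andP [mj jf] [i2 [j2 [d2 [P E2 O]]]]] := tab_cell H2 E.
  have [_ /andP [mj2 jf2] _] := tab_cell H2 E2.
  by rewrite P E2 O !eqxx jf jf2 -!leqNgt mj mj2.
- rewrite /rowb; case E: (getT T i j) => [[l d]|] //; case E2: (getT T i j.+1) => [[l2 d2]|] //.
  exact: tab_row H2 _ _ _ _ _ _ E E2.
- rewrite /colb; case E: (getT T i j) => [[l d]|] //; case E2: (getT T i.+1 j) => [[l2 d2]|] //.
  exact: tab_col H2 _ _ _ _ _ _ E E2.
- by rewrite /labb; case E: (getT T i j) => [[l d]|] //; have [] := tab_cell H2 E.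
Qed.

Definition cellwt (o : option ('I_n * 'I_4)) : S :=
  if o is Some (l, d) then
    if val d == 0%N then 'X_l else if val d == 2%N then t *: 'X_l else 1
  else 1.

Definition Twt (T : fillT) : S := \prod_(c : 'I_M * 'I_M) cellwt (T c).

Definition TabSum k f : S := \sum_(T : fillT | tabb f k T) Twt T.

Lemma Twt_getT T : Twt T = \prod_(i < M) \prod_(j < M) cellwt (getT T i j).
Proof.
rewrite pair_big /= /Twt; apply: eq_bigr => -[i j] _ /=; by rewrite getT_ord.
Qed.

Definition rowwt f g (l : 'I_n) i : S :=
  (t *: 'X_l) ^+ (seg_lo f g i - g i) * 'X_l ^+ (seg_hi f g i - seg_lo f g i)./2.

Lemma prod_row f g l i : (g i <= f i)%N -> (f i <= M)%N -> gap_ok f g i ->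
  (seg_lo f g i <= f i)%N -> (seg_hi f g i <= f i)%N ->
  \prod_(j < M) (if (g i <= j < f i)%N then cellwt (Some (l, inord (dirn f g i j))) else 1)
  = rowwt f g l i.
Proof.
move=> gf fM /andP [lu ev] lf uf.
have gl : (g i <= seg_lo f g i)%N by rewrite leq_max leqnn.
rewrite -(big_mkord xpredT (fun j : nat => if (g i <= j < f i)%N then
  cellwt (Some (l, inord (dirn f g i j))) else 1)).
rewrite (big_cat_nat (n := g i)) ?leq0n ?(leq_trans gf) //= big_nat big1 ?mul1r; last first.
  by move=> j /andP [_ jg]; rewrite leqNgt jg.
rewrite (big_cat_nat (n := f i)) //= [X in _ * X]big_nat [X in _ * X]big1 ?mulr1; last first.
  by move=> j /andP [fj _]; rewrite [(j < _)%N]ltnNge fj andbF.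
rewrite (big_cat_nat (n := seg_lo f g i)) //= /rowwt; congr (_ * _).
  rewrite -prodr_const_nat; apply: eq_big_nat => j /andP [gj jl].
  by rewrite gj (leq_trans jl lf) /cellwt val_dirn /dirn jl.
rewrite (big_cat_nat (n := seg_hi f g i)) //= [X in _ * X]big_nat [X in _ * X]big1 ?mulr1; last first.
  move=> j /andP [uj jf]; rewrite jf (leq_trans (leq_trans gl lu) uj) /cellwt val_dirn /dirn.
  by rewrite ltnNge (leq_trans lu uj) uj.
rewrite -(@prod_alternating _ 'X_l (seg_lo f g i)).
have -> : (seg_lo f g i + (seg_hi f g i - seg_lo f g i)./2.*2 = seg_hi f g i)%N by lia.
apply: eq_big_nat => j /andP [lj ju].
rewrite (leq_trans gl lj) (leq_trans ju uf) /cellwt val_dirn /dirn ltnNge lj leqNgt ju /=.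
by case: odd.
Qed.

End TabSum.

(** * Splitting a sum over tableaux by the shape of the smaller labels *)

Section TabPaths.
Variables (R : comRingType) (n M : nat) (t : R) (mu : nat -> nat).
Local Notation S := {mpoly R[n]}.
Local Notation fillT := {ffun 'I_M * 'I_M -> option ('I_n * 'I_4)}.
Local Notation bounded := (bounded M).
Hypotheses (mu_bounded : bounded mu) (mu_decr : decr mu).

Definition layer (k : nat) (T : fillT) (i : nat) : nat :=
  find (predC (fun j => (j < mu i)%N || lt_lab k (getT T i j))) (iota 0 M).

Lemma layerE f k k' T : decr f -> tableau f mu k' (getT T) ->
  forall i j, (j < layer k T i)%N = (j < mu i)%N || lt_lab k (getT T i j).
Proof.
move=> fd H i j.
rewrite /layer (@find_downclosed (fun j => (j < mu i)%N || lt_lab k (getT T i j))) // {j} => j.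
  case/orP => [/ltnW -> //|]; case: (ltnP j (mu i)) => //= mj.
  case E: (getT T i j.+1) => [[l d]|] //= lk; have [_ /andP [_ jf] _] := tab_cell H E.
  have [|l2 [d2 E2]] := tab_some H (i := i) (j := j); first by rewrite mj ltnW.
  by rewrite E2 /=; apply: leq_ltn_trans (tab_row H E2 E) lk.
case/orP => [/mu_bounded [] //|]; case: (ltnP j M) => // Mj.
by rewrite getT_out // negb_and -!leqNgt Mj orbT.
Qed.

Variables (W K : nat).

Definition is_layer k r T := (count id r == K) && [forall i : 'I_K, rowlen r i == layer k T i].

Section Step.
Variables (s : seq bool) (l : 'I_n).
Hypotheses (sW : size s = W) (sK : count id s = K) (s_bounded : bounded (rowlen s)).

Let sd : decr (rowlen s). Proof. move=> i; exact: rowlen_decr. Qed.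

Lemma is_layerP r T : tabb mu (rowlen s) l.+1 T -> is_layer l r T ->
  forall i j, (j < rowlen r i)%N = (j < mu i)%N || lt_lab l (getT T i j).
Proof.
move=> /(tabbP mu_bounded _ _ s_bounded) [ms H] /andP [/eqP rK /forallP E] i j.
have LE := layerE l sd H; rewrite -LE; congr (j < _)%N.
case: (ltnP i K) => iK; first by apply/eqP/(E (Ordinal iK)).
rewrite rowlen_ge ?rK //; apply/esym/eqP; rewrite -leqn0.
by rewrite -(@rowlen_ge s i) ?sK //; apply: (layer_le ms H LE).
Qed.

Lemma ex_layer T : tabb mu (rowlen s) l.+1 T ->
  exists2 r, r \in words W & forall r', r' \in words W -> is_layer l r' T = (r' == r).
Proof.
move=> Tt; have [ms H] := tabbP mu_bounded _ _ s_bounded Tt.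
have LE := layerE l sd H.
have g0 : layer l T K = 0%N.
  by apply/eqP; rewrite -leqn0 -(@rowlen_ge s K) ?sK //; apply: (layer_le ms H LE).
have gC : (layer l T 0 <= W - K)%N.
  apply: leq_trans (layer_le ms H LE 0) _.
  by have := rowlen_bound s 0; rewrite sW sK; lia.
have [w1 w2 w3] := word_of_rows (layer_decr sd mu_decr H LE) gC g0.
have KW : (K <= W)%N by rewrite -sK -sW count_size.
exists (word_of 0 (W - K) (layer l T) K); first by rewrite mem_words w1 subnKC.
move=> r'; rewrite mem_words => /eqP r'W; apply/idP/eqP => [/andP [/eqP rK /forallP E]|->].
  apply: rowlen_inj; rewrite ?w1 ?w2 ?subnKC // rK => i iK.
  by rewrite w3; apply/eqP/(E (Ordinal iK)).
by rewrite /is_layer w2 eqxx /=; apply/forallP => i; rewrite w3.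
Qed.

Lemma strip_rows r : size r = W -> count id r = K ->
  strip (t%:MP) 'X_l s r false false =
  if all (gap_ok (rowlen s) (rowlen r)) (iota 0 K) then \prod_(i < K) rowwt t (rowlen s) (rowlen r) l i else 0.
Proof.
move=> rW rK; rewrite /strip sexp_rows ?sW ?sK ?rK //; case: ifP => // _.
rewrite /rowwt -!prodrXr -big_split /=; apply: eq_bigr => i _.
by rewrite exprD exprZn -mul_mpolyC rmorphXn; ring.
Qed.

(** Erasing the label [l] and gluing it back are inverse bijections between the fillings whose
    smaller labels occupy [r] and the fillings of [r]. As the strip can be filled in one way only,
    its contribution is the product of the [rowwt], which is the weight of the sweep. *)
Lemma sum_layer r : r \in words W ->
  \sum_(T : fillT | tabb mu (rowlen s) l.+1 T && is_layer l r T) Twt t T =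
  strip (t%:MP) 'X_l s r false false * TabSum n M t mu l (rowlen r).
Proof.
rewrite mem_words => /eqP rW; case: (eqVneq (count id r) K) => [rK|rK]; last first.
  rewrite big_pred0 => [|T]; last by rewrite /is_layer (negbTE rK) andbF.
  rewrite /strip; case E: (sexp _ _ _ _) => [e|]; last by rewrite mul0r.
  by have := sexp_count E; rewrite !addn0 sK => E'; rewrite E' eqxx in rK.
rewrite strip_rows //; case: ifP => [/allP okK|nok]; last first.
  rewrite mul0r big_pred0 // => T; apply/negP => /andP [Tt Tl].
  have [ms H] := tabbP mu_bounded _ _ s_bounded Tt.
  have gE := is_layerP Tt Tl; case/negP: (negbT nok); apply/allP => i _.
  exact: (layer_gap_ok sd mu_decr ms H gE).
have rd : decr (rowlen r) by move=> i; apply: rowlen_decr.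
have ok i : gap_ok (rowlen s) (rowlen r) i.
  case: (ltnP i K) => iK; first by apply: okK; rewrite mem_iota.
  have z j : (K <= j)%N -> rowlen s j = 0%N /\ rowlen r j = 0%N.
    by move=> Kj; rewrite !rowlen_ge ?sK ?rK.
  have [[a1 a2] [a3 _]] := (z i iK, z i.+1 (leqW iK)).
  by rewrite /gap_ok /seg_lo /seg_hi a1 a2 a3; case: (i) => [|i'] //; rewrite min0n.
have rs i : (rowlen r i <= rowlen s i)%N by apply: (gf_le ok).
have r_bounded : bounded (rowlen r) by move=> i j L; apply: s_bounded; apply: leq_trans (rs i).
have outG (T' : fillT) i j : tableau (rowlen r) mu l (getT T') ->
    glue (rowlen s) (rowlen r) l (getT T') i j <> None -> (i < M)%N /\ (j < M)%N.
  move=> H /eqP; rewrite /glue; case: ifP => [/andP [_ /s_bounded] //|_].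
  case: (boolP ((i < M) && (j < M))%N) => [/andP [] //|out]; by rewrite (getT_out T' out).
have outR (T : fillT) i j : restr l (getT T) i j <> None -> (i < M)%N /\ (j < M)%N.
  rewrite /restr; case: (boolP ((i < M) && (j < M))%N) => [/andP [] //|out].
  by rewrite (getT_out T out).
rewrite (reindex_onto (fun T' : fillT => toT M (glue (rowlen s) (rowlen r) l (getT T')))
   (fun T => toT M (restr l (getT T)))) /=; last first.
  move=> T /andP [Tt Tl]; have [ms H] := tabbP mu_bounded _ _ s_bounded Tt.
  have gE := is_layerP Tt Tl.
  rewrite -[RHS]toTK; apply/ffunP => -[i j]; rewrite !ffunE /=.
  rewrite -(layer_glue sd mu_decr H gE (l := l) i j) // /glue; case: ifP => // _.
  by rewrite getTK // => i' j'; apply: outR.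
rewrite mulr_sumr (eq_bigl (tabb mu (rowlen r) l)) => [|T'].
  apply: eq_bigr => T' Tt'; have [mr H'] := tabbP mu_bounded _ _ r_bounded Tt'.
  have z i : (K <= i)%N || (M <= i)%N -> rowlen s i = 0%N.
    case/orP => H; first by rewrite rowlen_ge ?sK.
    by case E: (rowlen s i) => [|j] //; have [] := s_bounded (i := i) (j := j); rewrite ?E // ltnNge H.
  rewrite !Twt_getT (@prod_ord_resize _ (rowwt t (rowlen s) (rowlen r) l) K M) => [|i /z si]; last first.
    have [r0 s1] : rowlen r i = 0%N /\ rowlen s i.+1 = 0%N by have := rs i; have := sd i; lia.
    by rewrite /rowwt /seg_lo /seg_hi r0 s1 si; case: (i) => [|?]; rewrite ?min0n !expr0 mulr1.
  rewrite -big_split; apply: eq_bigr => i _ /=.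
  have := ok i; rewrite /gap_ok => /andP [lu _].
  have uf : (seg_hi (rowlen s) (rowlen r) i <= rowlen s i)%N by rewrite /seg_hi; case: (nat_of_ord i) => // i'; apply: geq_minl.
  have iM : (rowlen s i <= M)%N.
    by case E: (rowlen s i) => [|j] //; have [] := s_bounded (i := i) (j := j); rewrite ?E.
  rewrite -(prod_row (M := M)) // ?(leq_trans lu) // -big_split; apply: eq_bigr => j _ /=.
  rewrite getTK; last by move=> ? ?; apply: outG.
  rewrite /glue; case: ifP => L; last by rewrite mul1r.
  case E: (getT T' i j) => [[l' d]|]; last by rewrite /= mulr1.
  by have [_ + _] := tab_cell H' E; lia.
apply/idP/idP => [/andP [/andP [Tt Tl] /eqP E]|Tt'].
  set T := toT M _ in Tt Tl E.
  have [ms H] := tabbP mu_bounded _ _ s_bounded Tt.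
  have gE := is_layerP Tt Tl.
  apply/(tabbP mu_bounded) => //; split; first by move=> i; apply: (layer_ge gE).
  rewrite -E; have := layer_restr H gE; case=> c1 c2 c3 c4; split.
  - move=> i j l' d; rewrite getTK => [|? ?]; last exact: outR.
    case/c1 => ? ? [i2 [j2 [d2 [? ? ?]]]]; split=> //; exists i2, j2, d2.
    by rewrite getTK // => ? ?; apply: outR.
  - move=> i j /c2 [l' [d ?]]; exists l', d; rewrite getTK // => ? ?; exact: outR.
  - by move=> i j l1 d1 l2 d2; rewrite !getTK; first [exact: c3 | move=> ? ?; exact: outR].
  - by move=> i j l1 d1 l2 d2; rewrite !getTK; first [exact: c4 | move=> ? ?; exact: outR].
have [mr H'] := tabbP mu_bounded _ _ r_bounded Tt'.
set T := toT M _.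
have G' i j : getT T i j = glue (rowlen s) (rowlen r) l (getT T') i j by apply: getTK => ? ?; apply: outG.
have HG : tableau (rowlen s) mu l.+1 (getT T).
  have := glue_tableau sd rd mr ok H'; case=> c1 c2 c3 c4; split.
  - move=> i j l' d; rewrite G' => /c1 [? ? [i2 [j2 [d2 [? ? ?]]]]]; split=> //.
    by exists i2, j2, d2; rewrite G'.
  - by move=> i j /c2 [l' [d ?]]; exists l', d; rewrite G'.
  - by move=> i j l1 d1 l2 d2; rewrite !G'; exact: c3.
  - by move=> i j l1 d1 l2 d2; rewrite !G'; exact: c4.
have Tt : tabb mu (rowlen s) l.+1 T.
  by apply/(tabbP mu_bounded) => //; split=> // i; apply: leq_trans (mr i) (rs i).
rewrite Tt /=; apply/andP; split.
  rewrite /is_layer rK eqxx /=; apply/forallP => i.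
  rewrite eqn_leq; apply/andP; split; rewrite leqNgt; apply/negP => L.
    have := glue_layer (rowlen s) mr H' i (layer l T i).
    by rewrite L -G' -(layerE l sd HG) ltnn.
  have := layerE l sd HG i (rowlen r i); rewrite L G'.
  by rewrite -(glue_layer (rowlen s) mr H') ltnn.
apply/eqP; rewrite -[RHS]toTK; apply/ffunP => -[i j]; rewrite !ffunE /=.
by rewrite -[RHS](restr_glue (rowlen s) H') /restr G'.
Qed.

End Step.
End TabPaths.

Definition xvar (R : comNzRingType) (n k : nat) : {mpoly R[n]} :=
  if insub k is Some i then 'X_i else 0.

Section Paths.
Variables (R : comRingType) (n M : nat) (t : R) (mu : nat -> nat).
Hypotheses (mu_bounded : bounded M mu) (mu_decr : decr mu).
Variables (W K : nat) (s0 : seq bool).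
Hypotheses (s0W : size s0 = W) (s0K : count id s0 = K) (s0mu : forall i, rowlen s0 i = mu i).

Lemma TabSum_step s (l : 'I_n) : size s = W -> count id s = K -> bounded M (rowlen s) ->
  TabSum n M t mu l.+1 (rowlen s) =
  \sum_(r <- words W) strip (t%:MP) 'X_l s r false false * TabSum n M t mu l (rowlen r).
Proof.
move=> sW sK sb; rewrite /TabSum (eq_bigr (fun T => \sum_(r <- words W)
    if is_layer mu K l r T then Twt t T else 0)).
  rewrite exchange_big /=; apply: eq_big_seq => r rW.
  by rewrite -(sum_layer t mu_bounded mu_decr l sW sK sb rW) -big_mkcondr.
move=> T Tt; have [r rW E] := ex_layer mu_bounded mu_decr sW sK sb Tt.
rewrite (bigD1_seq r) ?words_uniq //= E // eqxx big_seq_cond big1 ?addr0 //.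
by move=> r' /andP [r'W /negbTE nr]; rewrite E // nr.
Qed.

Lemma TabSum0 s : size s = W -> count id s = K -> bounded M (rowlen s) ->
  TabSum n M t mu 0 (rowlen s) = (s == s0)%:R.
Proof.
move=> sW sK sb.
pose T0 : {ffun 'I_M * 'I_M -> option ('I_n * 'I_4)} := [ffun _ => None].
have T0E i j : getT T0 i j = None.
  by rewrite /getT; case: insub => // a; case: insub => // b; rewrite ffunE.
have T0P T : tabb mu (rowlen s) 0 T = (T == T0) && (s == s0).
  apply/idP/idP => [|/andP [/eqP -> /eqP ->]].
    move/(tabbP mu_bounded _ _ sb) => [ms H].
    have N i j : getT T i j = None.
      by case E: (getT T i j) => [[l d]|] //; have [] := tab_cell H E.
    apply/andP; split.
      by rewrite -(toTK T); apply/eqP/ffunP => -[i j]; rewrite !ffunE /= N.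
    apply/eqP/rowlen_inj; rewrite ?sW ?sK // => i _; rewrite s0mu.
    apply/eqP; rewrite eqn_leq ms andbT leqNgt; apply/negP => L.
    by have [|l [d]] := tab_some H (i := i) (j := mu i); rewrite ?leqnn ?L ?N.
  have s0b : bounded M (rowlen s0) by move=> i j; rewrite s0mu; apply: mu_bounded.
  apply/(tabbP mu_bounded) => //; split=> [i|]; first by rewrite s0mu.
  split=> [i j l d|i j|i j l1 d1 l2 d2|i j l1 d1 l2 d2]; rewrite ?T0E //.
  by rewrite s0mu; lia.
rewrite /TabSum (eq_bigl _ _ T0P); case: (s == s0); last by apply: big_pred0 => T; rewrite andbF.
rewrite (eq_bigl (pred1 T0)) => [|T]; last by rewrite andbT.
by rewrite big_pred1_eq /Twt big1 // => c _; rewrite ffunE.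
Qed.

Lemma TabSum_paths k s : (k <= n)%N -> size s = W -> count id s = K -> bounded M (rowlen s) ->
  TabSum n M t mu k (rowlen s) = paths W (t%:MP) (@xvar R n) s0 k s.
Proof.
elim: k s => [|k IH] s kn sW sK sb; first by rewrite TabSum0.
rewrite (@TabSum_step s (Ordinal kn)) //=; apply: eq_big_seq => r; rewrite mem_words => /eqP rW.
rewrite /xvar insubT /=.
case: (strip_neq0P (t%:MP) 'X_(Ordinal kn) s r) => [->|[e E]]; first by rewrite !mul0r.
have rK : count id r = K by rewrite -sK (sexp_count E) !addn0.
congr (_ * _); apply: IH => //; first exact: ltnW.
move=> i j L; apply: sb; apply: leq_trans L _.
move: E; rewrite sexp_rows ?sW ?rW ?sK ?rK //; case: ifP => // /allP ok _.
case: (ltnP i K) => iK; last by rewrite !rowlen_ge ?sK ?rK.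
have : gap_ok (rowlen s) (rowlen r) i by apply: ok; rewrite mem_iota.
by rewrite /gap_ok /seg_lo /seg_hi; case: (i) => [|?]; lia.
Qed.
End Paths.

Lemma eq_tabb n M (mu f f' : nat -> nat) k (T : {ffun 'I_M * 'I_M -> option ('I_n * 'I_4)}) :
  f =1 f' -> tabb mu f k T = tabb mu f' k T.
Proof.
move=> E; rewrite /tabb; congr andb; first by apply: eq_forallb => i; rewrite E.
apply: eq_forallb => c; congr andb; rewrite /cellb.
case: (getT T _ _) => [[l d]|]; last by rewrite E.
by rewrite E; case: partner => [[i2 j2]|] //; rewrite E.
Qed.

Lemma xweight_Twt (R : comRingType) n la (T : filling n la) (t : R) :
  (t ^+ nvert T) *: xweight R T = Twt t T.
Proof.
rewrite /nvert -sum1_card /xweight /Twt (big_morph (fun k => t ^+ k) (exprD t) (expr0 t)).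
rewrite big_mkcond /= -scaler_prod; apply: eq_bigr => c _.
rewrite inE /cellwt; case: (T c) => [[l d]|]; last by rewrite scale1r.
by case: d => [[|[|[|d]]] Hd] /=; rewrite ?expr1 ?scale1r.
Qed.

Lemma Gskew_TabSum (R : comRingType) n la mu (t : R) :
  (forall i, nth 0%N mu i <= nth 0%N la i)%N ->
  Gskew n la mu t = TabSum n (gridM la) t (nth 0%N mu) n (nth 0%N la).
Proof.
move=> H; rewrite /Gskew /TabSum; apply: eq_big => [T|T _]; last exact: xweight_Twt.
rewrite /is_domino_tableau /tabb.
have -> : [forall i : 'I_(gridM la), (nth 0 mu i <= nth 0 la i)%N] by apply/forallP.
apply: eq_forallb => c /=.
rewrite -andbA; congr [&& _, _ & _].
have -> : labb n (getT T) c.1 c.2 by rewrite /labb; case: (getT _ _ _) => [[l d]|].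
by rewrite andbT.
Qed.

(** * The 2-core *)

Fixpoint alt (s : seq nat) : int := if s is x :: s' then x%:Z - alt s' else 0.

(** Row [i] contributes the sum of (-1)^(i+j) over its cells, so that a domino
    contributes nothing and [oddalt] is an invariant of the 2-core. *)
Definition oddalt (s : seq nat) : int := alt [seq nat_of_bool (odd x) | x <- s].

Definition is_part (la : seq nat) := sorted geq la && all (ltn 0) la.

Lemma sorted_geqP s :
  reflect (forall j, nth 0%N s j.+1 <= nth 0%N s j)%N (sorted geq s).
Proof.
apply: (iffP (sortedP 0%N)) => H j; last by move=> _; apply: H.
case: (ltnP j.+1 (size s)) => L; first exact: H.
by rewrite nth_default.
Qed.

Lemma sorted_drop0 s : sorted geq s -> s = drop0 s ++ nseq (size s - size (drop0 s)) 0%N.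
Proof.
elim: s => // x s IH H; have ss := path_sorted H.
have sz : (size (drop0 s) <= size s)%N by rewrite size_filter count_size.
have E := IH ss; rewrite /= /drop0 /= -/(drop0 s); case: ltnP => x0.
  by rewrite /= subSS -E.
have x0' : x = 0%N by apply/eqP; rewrite -leqn0.
have Z : all (pred1 0%N) s.
  move: (order_path_min (rev_trans leq_trans) H); apply: sub_all => y /=.
  by rewrite /geq /= x0' leqn0.
have -> : drop0 s = [::].
  rewrite /drop0; apply/eqP; rewrite -size_eq0 size_filter -leqn0 leqNgt -has_count.
  by apply/hasPn => y ys; have /allP /(_ _ ys) /eqP -> := Z.
by rewrite subn0 /= x0'; congr cons; apply/all_pred1P.
Qed.

Lemma nth_drop0 s i : sorted geq s -> nth 0%N (drop0 s) i = nth 0%N s i.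
Proof.
move=> H; rewrite {2}(sorted_drop0 H) nth_cat; case: ltnP => // L.
by rewrite nth_nseq if_same nth_default.
Qed.

Lemma is_part_drop0 s : sorted geq s -> is_part (drop0 s).
Proof.
move=> H; rewrite /is_part; apply/andP; split; last exact: filter_all.
by apply: sorted_filter H; apply/rev_trans/leq_trans.
Qed.

Lemma sumn_drop0 s : sumn (drop0 s) = sumn s.
Proof. by elim: s => //= x s <-; rewrite /drop0 /=; case: x. Qed.

Lemma alt_zeros s k : alt (s ++ nseq k 0%N) = alt s.
Proof. by elim: s => [|x s IH] /=; [elim: k => //= k -> | rewrite IH]. Qed.

Lemma oddalt_drop0 s : sorted geq s -> oddalt (drop0 s) = oddalt s.
Proof.
by move=> H; rewrite /oddalt {2}(sorted_drop0 H) map_cat map_nseq alt_zeros.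
Qed.

Lemma oddalt_set1 s i y : (i < size s)%N -> odd y = odd (nth 0%N s i) ->
  oddalt (set_nth 0%N s i y) = oddalt s.
Proof.
rewrite /oddalt; elim: s i => // x s IH [|i] /= H E; first by rewrite E.
by rewrite IH.
Qed.

Lemma oddalt_set2 s i y : (i.+1 < size s)%N -> nth 0%N s i = nth 0%N s i.+1 ->
  oddalt (set_nth 0%N (set_nth 0%N s i y) i.+1 y) = oddalt s.
Proof.
rewrite /oddalt; elim: s i => // x s IH [|i] /= H E; last by rewrite IH.
by case: s H E {IH} => //= z s _ ->; rewrite !opprB ![_ + (_ - _)]addrC !subrK.
Qed.

Lemma domino_removalsP la mu : mu \in domino_removals la ->
  exists2 i, (i < size la)%N & let l := nth 0%N la in
   [/\ (2 <= l i)%N, (l i.+1 <= l i - 2)%N & mu = drop0 (set_nth 0%N la i (l i - 2)%N)] \/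
   [/\ (0 < l i)%N, l i = l i.+1, (l i.+2 <= l i.+1 - 1)%N &
       mu = drop0 (set_nth 0%N (set_nth 0%N la i (l i - 1)%N) i.+1 (l i.+1 - 1)%N)].
Proof.
move=> /flattenP [s /mapP [i]]; rewrite mem_iota /= => L ->.
rewrite mem_cat => /orP []; case: ifP => // H; rewrite inE => /eqP ->; exists i => //=.
  by left; case/andP: H.
by right; case/andP: H => /andP [? /eqP ?] ?.
Qed.

Lemma removal_spec la mu : is_part la -> mu \in domino_removals la ->
  [/\ is_part mu, (sumn mu).+2 = sumn la, oddalt mu = oddalt la &
      forall i, (nth 0 mu i <= nth 0 la i)%N].
Proof.
case/andP => /[dup] ss /sorted_geqP sd pos /domino_removalsP [i iL /= [[H1 H2 ->]|[H1 H2 H3 ->]]].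
  pose x := set_nth 0%N la i (nth 0%N la i - 2)%N; rewrite -/x.
  have xE j : nth 0%N x j = if j == i then (nth 0 la i - 2)%N else nth 0%N la j.
    by rewrite /x nth_set_nth.
  have sx : sorted geq x.
    apply/sorted_geqP => j; rewrite !xE; have := sd j.
    by case: eqP => [<-|_]; case: eqP => [->|_]; lia.
  split; first exact: is_part_drop0.
  - rewrite sumn_drop0 sumn_set_nth iL muln1.
    have : (nth 0 la i <= sumn la)%N by rewrite -(cat_take_drop i la) sumn_cat (drop_nth 0%N) // nth_cat size_take iL ltnn subnn /=; lia.
    lia.
  - rewrite oddalt_drop0 // oddalt_set1 //; lia.
  - by move=> j; rewrite nth_drop0 // xE; case: eqP => [->|_] //; lia.
rewrite -H2.
pose x := set_nth 0%N (set_nth 0%N la i (nth 0 la i - 1)%N) i.+1 (nth 0 la i - 1)%N; rewrite -/x.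
have iL1 : (i.+1 < size la)%N.
  by rewrite ltnNge; apply/negP => L; move: H1; rewrite H2 nth_default.
have xE j : nth 0%N x j = if (j == i) || (j == i.+1) then (nth 0 la i - 1)%N else nth 0%N la j.
  by rewrite /x nth_set_nth /= nth_set_nth /=; case: (j == i.+1); rewrite ?orbT ?orbF.
have sx : sorted geq x.
  apply/sorted_geqP => j; rewrite !xE eqSS; have := sd j.
  case: (j =P i) => [->|ji]; first by rewrite orbT.
  rewrite orbF; case: (j =P i.+1) => [->|ji']; last first.
    by case: eqP => [E'|_] /=; rewrite -?E'; lia.
  have -> : (i.+2 == i) = false by lia.
  by rewrite -H2 /=; move: H2 H3; lia.
split; first exact: is_part_drop0.
- rewrite sumn_drop0 /x sumn_set_nth sumn_set_nth nth_set_nth /= size_set_nth.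
  have -> : (i.+1 == i) = false by lia.
  have -> : maxn i.+1 (size la) = size la by lia.
  rewrite iL iL1 !muln1 -H2.
  have : (nth 0 la i + nth 0 la i.+1 <= sumn la)%N.
    rewrite -{3}(cat_take_drop i la) sumn_cat (drop_nth 0%N) // (drop_nth 0%N) //=; lia.
  lia.
- by rewrite oddalt_drop0 // oddalt_set2.
- move=> j; rewrite nth_drop0 // xE.
  by case: (j =P i) => [->|_] /=; [lia | case: eqP => [->|_] //; rewrite -H2; lia].
Qed.

Lemma deltaS r : delta r.+1 = r.+1 :: delta r.
Proof. by rewrite /delta -[in iota 1 _](addn1 r) iotaD rev_cat /= add1n. Qed.

Lemma size_delta r : size (delta r) = r.
Proof. by rewrite size_rev size_iota. Qed.

Lemma nth_delta r i : nth 0%N (delta r) i = (r - i)%N.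
Proof. by elim: r i => [|r IH] [|i] //=; rewrite deltaS //= IH. Qed.

(** From the bottom, each row is exactly one longer than the row below: an excess of two or more
    frees a horizontal domino, and equal lengths free a vertical one because the row after next is
    shorter by one. *)
Lemma no_removal la : is_part la -> domino_removals la = [::] -> la = delta (size la).
Proof.
case/andP => /sorted_geqP sd pos H.
have N mu : mu \in domino_removals la -> False by rewrite H.
have cnd i : (i < size la)%N ->
  ~ ((2 <= nth 0 la i) && (nth 0 la i.+1 <= nth 0 la i - 2))%N /\
  ~ [&& 0 < nth 0 la i, nth 0 la i == nth 0 la i.+1 & nth 0 la i.+2 <= nth 0 la i.+1 - 1]%N.
  move=> iL; split => C.
    apply: (N (drop0 (set_nth 0%N la i (nth 0%N la i - 2)%N))).
    apply/flattenP; eexists; first by apply/mapP; exists i; [rewrite mem_iota | reflexivity].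
    by rewrite C mem_cat inE eqxx.
  apply: (N (drop0 (set_nth 0%N (set_nth 0%N la i (nth 0 la i - 1)%N) i.+1 (nth 0 la i.+1 - 1)%N))).
  apply/flattenP; eexists; first by apply/mapP; exists i; [rewrite mem_iota | reflexivity].
  by rewrite -andbA C mem_cat inE eqxx orbT.
have gt0 i : (i < size la)%N -> (0 < nth 0 la i)%N.
  by move=> iL; apply: (allP pos); apply: mem_nth.
have key k : (k <= size la)%N -> forall j, (j <= k)%N -> nth 0%N la (size la - j) = j.
  elim: k => [|k IH] kL j; first by rewrite leqn0 => /eqP ->; rewrite subn0 nth_default.
  have {}IH := IH (ltnW kL); rewrite leq_eqVlt ltnS => /orP [/eqP -> {j}|]; last exact: IH.
  set i := (size la - k.+1)%N; have iL : (i < size la)%N by rewrite /i; lia.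
  have i1 : i.+1 = (size la - k)%N by rewrite /i; lia.
  have [c1 c2] := cnd i iL; have p := gt0 i iL; have s1 := sd i.
  have E1 := IH k (leqnn k); rewrite i1 E1 in c1 c2 s1.
  have neq : nth 0%N la i <> k.
    move=> E; apply: c2; rewrite p E eqxx /=.
    have k0 : (0 < k)%N by rewrite -E.
    have i2 : (size la - k).+1 = (size la - k.-1)%N by lia.
    by rewrite i2 IH ?leq_pred // subn1.
  lia.
apply: (@eq_from_nth _ 0%N); rewrite ?size_delta // => i iL.
rewrite nth_delta -[in LHS](subKn (ltnW iL)) (key (size la)) //; lia.
Qed.

Lemma core2_fuel_spec k la : is_part la -> (sumn la <= k)%N -> exists r,
  [/\ core2_fuel k la = delta r, oddalt la = oddalt (delta r) &
      forall i, (nth 0 (delta r) i <= nth 0 la i)%N].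
Proof.
elim: k la => [|k IH] la lap.
  case: la lap => [|x la]; first by exists 0%N.
  by case/andP => _ /= /andP [x0 _]; lia.
move=> /= lk; case E: (domino_removals la) => [|mu s].
  by exists (size la); rewrite -no_removal.
have [|mup S O L] := removal_spec lap (mu := mu); first by rewrite E inE eqxx.
have [|r [R1 R2 R3]] := IH mu mup; first by move: S lk; lia.
exists r; split=> //; first by rewrite -O.
by move=> i; apply: leq_trans (L i).
Qed.

(** For r = 0, 1, 2, 3, 4, ... the values are 0, 1, -1, 2, -2, ...; they are distinct, so the
    invariant identifies the core. *)
Lemma oddalt_delta r : oddalt (delta r) = if odd r then (uphalf r)%:Z else - (uphalf r)%:Z.
Proof.
rewrite /oddalt; elim: r => // r IH.
by rewrite deltaS [LHS]/= IH oddS; case E: (odd r) => /=; lia.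
Qed.

Lemma alt_delta r : alt (delta r) = uphalf r.
Proof. by elim: r => // r IH; rewrite deltaS [LHS]/= IH; lia. Qed.

Lemma oddparts_delta r : oddparts (delta r) = uphalf r.
Proof. by rewrite /oddparts; elim: r => // r IH; rewrite deltaS [LHS]/= IH /=; lia. Qed.

Lemma oddalt_delta_inj r r' : oddalt (delta r) = oddalt (delta r') -> r = r'.
Proof. by rewrite !oddalt_delta; case E: (odd r); case E': (odd r') => H; lia. Qed.

Lemma inP_oddalt r la : is_part la -> inP r la = (oddalt la == oddalt (delta r)).
Proof.
move=> lap; have [r' [E O _]] := core2_fuel_spec lap (leqnn _).
rewrite /inP /core2 E O; apply/eqP/eqP => [->//|/oddalt_delta_inj -> //].
Qed.

Lemma inP_contains r la : is_part la -> inP r la -> forall i, (nth 0 (delta r) i <= nth 0 la i)%N.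
Proof.
move=> lap /eqP H; have [r' [E _ L]] := core2_fuel_spec lap (leqnn _).
by rewrite -H /core2 E.
Qed.

(** * Statistics *)

Fixpoint oddholes (s : seq bool) : nat :=
  if s is b :: s' then ((~~ b && odd (count id s')) + oddholes s')%N else 0%N.

Lemma alt_rcons s x : alt (rcons s x) = alt s + (if odd (size s) then - x%:Z else x%:Z).
Proof. by elim: s => [|y s IH] /=; rewrite ?subr0 ?add0r // IH; case: odd => /=; lia. Qed.

Lemma oddalt_rcons s x :
  oddalt (rcons s x) = oddalt s + (if odd (size s) then - (odd x : nat)%:Z else (odd x : nat)%:Z).
Proof. by rewrite /oddalt map_rcons alt_rcons size_map. Qed.

Lemma size_rev_parts h s : size (rev (parts h s)) = count id s.
Proof. by rewrite size_rev size_parts. Qed.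

(** For a fixed even number of beads and [h = 0], the core is thus read off from the number of beads
    at odd positions. *)
Lemma oddalt_oddbeads s h :
  oddalt (rev (parts h s)) + (oddbeads s (odd h (+) odd (count id s)))%:Z = (uphalf (count id s))%:Z.
Proof.
elim: s h => [|[] s IH] h //=.
  rewrite rev_cons oddalt_rcons size_rev_parts; have := IH h; rewrite !add0n.
  by case: (odd h); case E: (odd (count id s)) => /=; lia.
by rewrite !add0n -(IH h.+1) /=; case: (odd h); case: (odd (count id s)).
Qed.

(** A column contributes 1 - 1 + 1 - ... to the alternating sum of the rows, that is, the parity of
    its length. *)
Lemma alt_oddholes s h :
  alt (rev (parts h s)) = (oddholes s)%:Z + (h * odd (count id s))%:Z.
Proof.
elim: s h => [|[] s IH] h /=; first by rewrite muln0.
  by rewrite rev_cons alt_rcons size_rev_parts IH add0n; case: odd => /=; lia.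
by rewrite IH; case: odd => /=; lia.
Qed.

(** The checkerboard sum cut along columns: [u] odd columns contribute 1 and [v] contribute -1. With
    the analogue for rows, [oddalt_oddparts], this shows that the differences halved in the
    exponents of [Str] are nonnegative and even. *)
Lemma oddalt_oddholes s h : exists u v : nat, (oddholes s = u + v)%N /\
  oddalt (rev (parts h s)) = u%:Z - v%:Z + (odd h && odd (count id s) : nat)%:Z.
Proof.
elim: s h => [|b s IH] h; first by exists 0%N, 0%N; rewrite andbF.
case: b => /=.
  have [u [v [E1 E2]]] := IH h; exists u, v; split; first by rewrite E1.
  rewrite rev_cons oddalt_rcons size_rev_parts E2.
  by case: (odd h); case: (odd (count id s)) => /=; lia.
have [u [v [E1 E2]]] := IH h.+1; rewrite E1 E2 /=.
case: (odd h); case: (odd (count id s)) => /=.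
- by exists u, v.+1; split; lia.
- by exists u, v; split; lia.
- by exists u.+1, v; split; lia.
- by exists u, v; split; lia.
Qed.

Lemma oddalt_oddparts s : exists u v : nat, oddparts s = (u + v)%N /\ oddalt s = u%:Z - v%:Z.
Proof.
rewrite /oddparts /oddalt; elim: s => [|x s [u [v [E1 E2]]]] /=; first by exists 0%N, 0%N.
exists (odd x + v)%N, u; rewrite E1 E2; split; lia.
Qed.

Lemma oddholes_columns s h : oddholes s =
  count odd [seq count (fun x => j <= x)%N (parts h s) | j <- iota h.+1 (size s - count id s)].
Proof.
elim: s h => [|[] s IH] h //=.
  rewrite subSS (IH h); congr (count _ _); apply/eq_in_map => j; rewrite mem_iota.
  by case: (leqP j h) => //; lia.
rewrite add0n subSn ?count_size //= (IH h.+1); congr (_ + _)%N.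
rewrite -(size_parts h.+1 s).
have : all (fun x => h < x)%N (parts h.+1 s).
  elim: {IH} s h => //= -[] s IH h /=; rewrite ?ltnSn ?IH //.
  by apply: sub_all (IH h.+1) => x /ltnW.
by rewrite all_count => /eqP ->.
Qed.

Lemma oddparts_conjp s : (head 0%N (drop0 (rev (parts 0 s))) <= size s - count id s)%N ->
  oddparts (conjp (drop0 (rev (parts 0 s)))) = oddholes s.
Proof.
move=> H; rewrite (oddholes_columns s 0) /oddparts /conjp.
set la := drop0 _ in H *.
have C j : (0 < j)%N -> count (fun x => j <= x)%N la = count (fun x => j <= x)%N (parts 0 s).
  move=> j0; rewrite /la /drop0 count_filter -[RHS]count_rev; apply: eq_count => x /=.
  by case: (leqP j x) => //; lia.
rewrite -(subnKC H) iotaD map_cat count_cat.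
rewrite -[LHS]addn0; congr (_ + _)%N.
  by congr (count _ _); apply/eq_in_map => j; rewrite mem_iota => /andP [j1 _]; rewrite C.
apply/esym/eqP; rewrite -leqn0 leqNgt -has_count; apply/hasPn => c /mapP [j].
rewrite mem_iota add1n => /andP [j1 _] ->; rewrite -C; last by lia.
suff -> : count (fun x => j <= x)%N la = 0%N by [].
apply/eqP; rewrite -leqn0 leqNgt -has_count; apply/hasPn => x xla; rewrite -ltnNge.
apply: leq_ltn_trans j1.
have srt : sorted geq la.
  apply: sorted_filter; first by apply/rev_trans/leq_trans.
  apply/sorted_geqP => i; exact: rowlen_decr.
have srt' := srt; rewrite /= in srt.
case: la srt xla {H C srt'} => // y la srt; rewrite inE => /orP [/eqP -> //|].
by move/(allP (order_path_min (rev_trans leq_trans) srt)).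
Qed.

Lemma dstat_cons x y l : dstat [:: x, y & l] = (y./2 + dstat l)%N.
Proof.
rewrite /dstat /= big_nat_recl //=; congr (_ + _)%N; apply: eq_big_nat => i /andP [i0 _].
by case: i i0 => // i _; rewrite !doubleS.
Qed.

(** Rows are taken in pairs; for lengths x and y it reduces to 4 floor(y/2) + 2 (y mod 2) = 2 y. By
    [alt_oddholes], [alt la] is the number of odd columns. *)
Lemma dstat_identity la :
  (4 * dstat la)%:Z + (oddparts la)%:Z + alt la = (sumn la)%:Z + oddalt la.
Proof.
move: {2}(size la) (leqnn (size la)) => m; elim: m la => [|m IH] [|x [|y la]] //= H.
- by rewrite /dstat big_geq.
- by rewrite /dstat big_geq.
- by rewrite /dstat big_geq // /oddparts /oddalt /=; case: odd; lia.
have := IH la (ltnW H); rewrite dstat_cons /oddparts /oddalt /=.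
move: (dstat la) (count odd la) (alt la) (sumn la) (alt _) => d o a' su e E.
by have := odd_double_half y; case: (odd x); case: (odd y) => /=; lia.
Qed.

Lemma leq_dstat la mu : (forall i, nth 0 la i <= nth 0 mu i)%N -> (size la <= size mu)%N ->
  (dstat la <= dstat mu)%N.
Proof.
move=> H S; rewrite /dstat.
have L : ((size la)./2.+1 <= (size mu)./2.+1)%N by rewrite ltnS half_leq.
rewrite (big_cat_nat (n := (size la)./2.+1) (p := (size mu)./2.+1)) //=.
by apply: leq_trans (leq_addr _ _); apply: leq_sum => i _; apply: half_leq.
Qed.

Lemma vword_stat (S : comNzRingType) (al be : S) s h :
  vword al be s (odd h) (odd (count id s)) =
  al ^+ count odd (parts h s) * be ^+ oddholes s.
Proof.
elim: s h => [|[] s IH] h /=; first by rewrite mulr1.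
  by rewrite add0n negbK IH exprD mulrA.
by rewrite add0n -[~~ odd h]/(odd h.+1) IH exprD mulrCA.
Qed.

Lemma possum_sumn s h k :
  possum s (h + k) = (sumn (parts h s) + sumn (iota k (count id s)))%N.
Proof.
elim: s h k => [|[] s IH] h k //=; first by rewrite -addnS IH add0n; lia.
by rewrite -addSn IH add0n.
Qed.

(** * Assembly *)

Definition shape (s : seq bool) : seq nat := drop0 (rev (parts 0 s)).

Lemma sorted_rev_parts s : sorted geq (rev (parts 0 s)).
Proof. by apply/sorted_geqP => i; apply: rowlen_decr. Qed.

Lemma shape_part s : is_part (shape s).
Proof. exact/is_part_drop0/sorted_rev_parts. Qed.

Lemma nth_shape s i : nth 0%N (shape s) i = rowlen s i.
Proof. exact/nth_drop0/sorted_rev_parts. Qed.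

Lemma sumn_shape s : sumn (shape s) = sumn (parts 0 s).
Proof. by rewrite sumn_drop0 sumn_rev. Qed.

Lemma oddparts_shape s : oddparts (shape s) = count odd (parts 0 s).
Proof.
rewrite /oddparts /shape /drop0 count_filter count_rev; apply: eq_count => x /=.
by case: x => // x; rewrite andbT.
Qed.

Lemma alt_shape s : alt (shape s) = (oddholes s)%:Z.
Proof.
rewrite -[RHS]addr0 -[X in _ + X]/((0 * odd (count id s))%N%:Z) -alt_oddholes.
by rewrite [in RHS](sorted_drop0 (sorted_rev_parts s)) alt_zeros.
Qed.

Lemma oddalt_shape s : oddalt (shape s) = oddalt (rev (parts 0 s)).
Proof. exact/oddalt_drop0/sorted_rev_parts. Qed.

Lemma size_part la : is_part la -> (size la <= sumn la)%N.
Proof. by case/andP => _; elim: la => //= x la IH /andP [x0 /IH]; lia. Qed.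

Lemma nth_leq_sumn la i : (nth 0 la i <= sumn la)%N.
Proof. by elim: la i => [|x la IH] [|i] //=; [lia | have := IH i; lia]. Qed.

Lemma eq_part la mu : is_part la -> is_part mu ->
  (forall i, nth 0%N la i = nth 0%N mu i) -> la = mu.
Proof.
move=> /andP [_ la0] /andP [_ mu0] H.
have S (a b : seq nat) : all (ltn 0) b -> (forall i, nth 0%N a i = nth 0%N b i) -> (size b <= size a)%N.
  move=> b0 E; rewrite leqNgt; apply/negP => L.
  have := allP b0 _ (mem_nth 0%N L); by rewrite -E nth_default.
apply: (@eq_from_nth _ 0%N) => [|i _ //].
by apply/eqP; rewrite eqn_leq S //= S.
Qed.

Lemma delta_part r : is_part (delta r).
Proof.
apply/andP; split; first by apply/sorted_geqP => i; rewrite !nth_delta; lia.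
by apply/allP => x; rewrite mem_rev mem_iota => /andP [].
Qed.

Lemma rowlen_gt0 s i : (0 < rowlen s i)%N -> (i < sumn (parts 0 s))%N.
Proof.
move=> H; rewrite -sumn_shape; apply: leq_trans (size_part (shape_part s)).
by rewrite ltnNge; apply/negP => L; rewrite -nth_shape nth_default in H.
Qed.

Lemma trailing_zeros s h : (0 < count id s)%N ->
  exists m, s = m ++ nseq (h + (size s - count id s) - last 0%N (parts h s)) false.
Proof.
elim: s h => //= b s IH h.
have L m k : (m <= k)%N -> nseq k false = nseq (k - m) false ++ nseq m false.
  by move=> mk; rewrite -nseqD subnK.
have cs := count_size id s.
case: b => [_|] /=; last first.
  rewrite add0n => c0; have [m E] := IH h.+1 c0; exists (false :: m).
  by rewrite {1}E /=; congr (_ :: _ ++ nseq _ _); lia.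
case: (posnP (count id s)) => [c0|c0]; last first.
  have [m E] := IH h c0; exists (true :: m).
  rewrite {1}E subSS /=; congr (_ :: _ ++ nseq (_ - _) _).
  by case: (parts h s) (size_parts h s) => //= E0; rewrite -E0 in c0.
exists [:: true] => /=; congr cons.
have -> : parts h s = [::] by apply/size0nil; rewrite size_parts.
rewrite c0 /= subSS subn0 addKn; apply/all_pred1P/allP => x xs.
move/eqP: c0; rewrite -leqn0 leqNgt -has_count => /hasPn /(_ _ xs) /=.
by case: x {xs}.
Qed.

Lemma last_parts s : last 0%N (parts 0 s) = rowlen s 0.
Proof. by rewrite /rowlen; case/lastP: (parts 0 s) => [|p x]; rewrite ?rev_rcons ?last_rcons. Qed.

Lemma sexp_refl s : sexp s s false false = Some (0, 0)%N.
Proof. by elim: s => //= -[] s ->. Qed.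

Lemma xvar_ordge (R : comNzRingType) n k : ordge 1 (@xvar R n k).
Proof.
rewrite /xvar; case: insubP => [i _ _|_]; last exact: ordge_zero.
move=> m; rewrite ltnS leqn0 mdeg_eq0 => /eqP ->; rewrite mcoeffX.
by case: eqP => // /(congr1 (@mdeg n)); rewrite mdeg1 mdeg0.
Qed.

Section Scale.
Variables (R : comNzRingType) (n W : nat) (t ga : {mpoly R[n]}) (x : nat -> {mpoly R[n]}).
Variable s0 : seq bool.

Lemma paths_lt k s : (possum s 0 < possum s0 0)%N -> paths W t x s0 k s = 0.
Proof.
elim: k s => [|k IH] s /= H; first by case: eqP H => // ->; rewrite ltnn.
apply: big1 => r _; case: (strip_neq0P t (x k) s r) => [->|[[i j] /(sexp_possum 0)]].
  by rewrite mul0r.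
by rewrite !mul0n !addn0 => E; rewrite IH ?mulr0 //; lia.
Qed.

Lemma paths_scale k s :
  paths W t (fun i => ga * x i) s0 k s =
  ga ^+ (possum s 0 - possum s0 0)./2 * paths W t x s0 k s.
Proof.
elim: k s => [|k IH] s /=; first by case: eqP => [->|_]; rewrite ?mulr0 // subnn mul1r.
rewrite mulr_sumr; apply: eq_bigr => r _; rewrite IH /strip.
case E: (sexp _ _ _ _) => [[i j]|]; last by rewrite !mul0r mulr0.
have := sexp_possum 0 E; rewrite !mul0n !addn0 => P.
(* Below the core the truncated difference loses its meaning, but there the path sum vanishes. *)
case: (ltnP (possum r 0) (possum s0 0)) => L; first by rewrite paths_lt // !mulr0.
have -> : ((possum s 0 - possum s0 0)./2 = i + (possum r 0 - possum s0 0)./2)%N by lia.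
by rewrite exprMn exprD; ring.
Qed.
End Scale.

(** * The window and the word of the core *)

Section Setup.
Variables (r N : nat).
Definition maxsize := (sumn (delta r) + N.*2)%N.
(** Two more bottom rows than needed, so that no bead enters the window from the
    left, and an even number of rows, which fixes the parities in [vword]. *)
Definition nrows := (maxsize.+2.*2)%N.
(** The longest row takes at most [maxsize] columns; the remaining [N.+1.*2] holes are those
    demanded by [padded]. *)
Definition ncols := (maxsize + N.+1.*2)%N.
Definition wlen := (nrows + ncols)%N.
Definition core_word := word_of 0 ncols (nth 0%N (delta r)) nrows.
Local Notation s0 := core_word.

Lemma delta_le : (r <= sumn (delta r))%N.
Proof. by have := size_part (delta_part r); rewrite size_delta. Qed.

Lemma core_wordP : [/\ size s0 = wlen, count id s0 = nrows &
  forall i, rowlen s0 i = nth 0%N (delta r) i].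
Proof.
have := delta_le => H; apply: word_of_rows; rewrite ?nth_delta /ncols /nrows /maxsize; try lia.
by move=> i; rewrite !nth_delta; lia.
Qed.

Lemma shape_core : shape s0 = delta r.
Proof.
apply: eq_part; [exact: shape_part | exact: delta_part | move=> i].
by rewrite nth_shape; have [_ _ ->] := core_wordP.
Qed.

Lemma possum_shape s : count id s = nrows ->
  possum s 0 = (sumn (shape s) + sumn (iota 0 nrows))%N.
Proof. by move=> <-; rewrite -[0%N in LHS]addn0 possum_sumn sumn_shape. Qed.

Lemma core_padded s : size s = wlen -> count id s = count id s0 ->
  (possum s 0 <= possum s0 0 + N.*2)%N -> padded N s.
Proof.
have [_ c0 _] := core_wordP; rewrite c0 => sW sK.
rewrite (possum_shape sK) (possum_shape c0) shape_core => P.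
have S : (sumn (parts 0 s) <= maxsize)%N by rewrite -sumn_shape /maxsize; lia.
have [m E] : exists m, s = m ++ nseq N.+1.*2 false.
  have [|m E] := @trailing_zeros s 0; first by rewrite sK.
  have H : (N.+1.*2 <= 0 + (size s - count id s) - last 0 (parts 0 s))%N.
    rewrite last_parts -nth_shape sW sK add0n.
    have := nth_leq_sumn (shape s) 0; rewrite sumn_shape /wlen /ncols; lia.
  exists (m ++ nseq ((0 + (size s - count id s) - last 0 (parts 0 s)) - N.+1.*2) false).
  by rewrite -catA -nseqD subnK // -E.
have sz : (2 <= size m)%N.
  have : (size s = size m + N.+1.*2)%N by rewrite E size_cat size_nseq.
  by rewrite sW /wlen /ncols /nrows; lia.
have z i : (maxsize <= i)%N -> rowlen s i = 0%N.
  move=> iL; case: (posnP (rowlen s i)) => // /rowlen_gt0; lia.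
have p0 : nth 0%N (parts 0 s) 0 = 0%N /\ nth 0%N (parts 0 s) 1 = 0%N.
  have R i : (i < nrows)%N -> nth 0%N (parts 0 s) i = rowlen s (nrows - i.+1).
    move=> L; rewrite /rowlen nth_rev ?size_parts ?sK; last by lia.
    by congr nth; lia.
  by rewrite !R ?z // /nrows; lia.
have szp : size (parts 0 s) = nrows by rewrite size_parts.
clear sW sK P S c0 z; move: E; case: m sz => [|b0 [|b1 m]] // _ E.
exists m; rewrite E; move: p0 szp; rewrite E /=.
have B h s' : all (leq h) (parts h s').
  by elim: s' h => //= -[] s' IH h /=; rewrite ?leqnn ?IH //; apply: sub_all (IH h.+1) => x /ltnW.
case: b0 {E}; case: b1 => //=.
- by move: (B 1%N (m ++ nseq N.+1.*2 false)) => /=; case: (parts _ _) => //= x p /andP [x0 _] [_ H] _; rewrite H in x0.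
- by case.
- by move: (B 2%N (m ++ nseq N.+1.*2 false)) => /=; case: (parts _ _) => //= x p /andP [x0 _] [H _] _; rewrite H in x0.
Qed.

Lemma core_sexp s : size s = wlen ->
  sexp s0 s false false = if s == s0 then Some (0, 0)%N else None.
Proof.
move=> sW; case: (eqVneq s s0) => [->|ne]; first exact: sexp_refl.
case E: (sexp s0 s false false) => [e|] //.
have [W0 c0 R0] := core_wordP; have sK := sexp_count E; rewrite !addn0 c0 in sK.
case/eqP: ne; apply: rowlen_inj; rewrite ?sW ?c0 // => i _.
move: E; rewrite sexp_rows ?W0 ?sW ?c0 //; case: ifP => // /allP ok _.
have {}ok j : gap_ok (rowlen s0) (rowlen s) j.
  case: (ltnP j nrows) => L; first by apply: ok; rewrite mem_iota.
  have [z1 [z2 z3]] : rowlen s j = 0%N /\ rowlen s0 j = 0%N /\ rowlen s0 j.+1 = 0%N.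
    by rewrite !rowlen_ge ?c0 -?sK //; apply: leqW.
  by rewrite /gap_ok /seg_lo /seg_hi z1 z2 z3; case: (j) => // ?; rewrite min0n.
rewrite R0 nth_delta.
(* From the top row down: consecutive rows of the core differ by at most one, so the even gap
   between [seg_lo] and [seg_hi] is zero, and row [i] of [s] is as long as that of the core. *)
elim: i => [|i IH].
  have := ok 0%N; rewrite /gap_ok /seg_lo /seg_hi !R0 !nth_delta; lia.
have := ok i.+1; rewrite /gap_ok /seg_lo /seg_hi !R0 !nth_delta IH; lia.
Qed.

End Setup.

(** * Partitions coded by functions and by words *)

Section Codes.
Variables (r N : nat).
Local Notation Ks := (maxsize r N).
Local Notation code := {ffun 'I_Ks -> 'I_Ks.+1}.

Definition code_word (f : code) : seq bool :=
  word_of 0 (ncols r N) (nth 0%N (code_seq f)) (nrows r N).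

Lemma nth_code_seq (f : code) (i : 'I_Ks) : nth 0%N (code_seq f) i = f i.
Proof. by rewrite /code_seq (nth_map i) ?size_enum_ord // nth_ord_enum. Qed.

Lemma size_code_seq (f : code) : size (code_seq f) = Ks.
Proof. by rewrite size_map size_enum_ord. Qed.

Lemma code_wordP (f : code) : sorted geq (code_seq f) ->
  [/\ size (code_word f) = wlen r N, count id (code_word f) = nrows r N,
      forall i, rowlen (code_word f) i = nth 0%N (code_seq f) i &
      shape (code_word f) = code_part f].
Proof.
move=> srt; have [|||w1 w2 w3] := @word_of_rows (ncols r N) (nth 0%N (code_seq f)) (nrows r N).
- exact/sorted_geqP.
- case: (ltnP 0 Ks) => H; last by rewrite nth_default // size_code_seq.
  rewrite (nth_code_seq f (Ordinal H)); have := ltn_ord (f (Ordinal H)); rewrite /ncols; lia.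
- by rewrite nth_default // size_code_seq /nrows; lia.
split=> //; apply: eq_part; [exact: shape_part | exact: is_part_drop0 | move=> i].
by rewrite nth_shape w3 nth_drop0.
Qed.

Definition in_range s := (count id s == nrows r N) && (sumn (shape s) <= Ks)%N.

Lemma sum_codes (S : nmodType) (g : seq bool -> S) :
  \sum_(s <- words (wlen r N) | in_range s) g s =
  \sum_(f : code | sorted geq (code_seq f) && (sumn (code_part f) <= Ks)%N) g (code_word f).
Proof.
transitivity (\sum_(f : code | sorted geq (code_seq f) && (sumn (code_part f) <= Ks)%N)
    \sum_(s <- words (wlen r N)) if s == code_word f then g s else 0); last first.
  apply: eq_bigr => f /andP [srt _]; have [w1 _ _ _] := code_wordP srt.
  rewrite (bigD1_seq (code_word f)) ?words_uniq ?mem_words ?w1 //= eqxx big1 ?addr0 //.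
  by move=> s /negbTE ->.
rewrite exchange_big [LHS]big_mkcond; apply: eq_big_seq => s. 

rewrite mem_words => /eqP sW.
rewrite -big_mkcondr; case: ifP => [/andP [/eqP sK sS]|no]; last first.
  rewrite big_pred0 // => f; apply/negP => /andP [/andP [srt S1] /eqP E].
  have [_ w2 _ w4] := code_wordP srt.
  by rewrite /in_range E w2 w4 eqxx S1 in no.
pose f0 : code := [ffun i : 'I_Ks => inord (rowlen s i)].
have Rle i : (rowlen s i <= Ks)%N.
  by apply: leq_trans sS; rewrite -nth_shape nth_leq_sumn.
have f0E i : nth 0%N (code_seq f0) i = rowlen s i.
  case: (ltnP i Ks) => L.
    by rewrite (nth_code_seq f0 (Ordinal L)) ffunE inordK // ltnS.
  rewrite nth_default ?size_code_seq //; apply/esym/eqP; rewrite -leqn0 leqNgt; apply/negP.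
  by move=> /rowlen_gt0; rewrite -sumn_shape; lia.
have srt0 : sorted geq (code_seq f0).
  by apply/sorted_geqP => i; rewrite !f0E; apply: rowlen_decr.
have [w1 w2 w3 w4] := code_wordP srt0.
have sE : s = code_word f0.
  by apply: rowlen_inj; rewrite ?w1 ?w2 // => i _; rewrite w3 f0E.
rewrite (big_pred1 f0) // => f /=; apply/andP/eqP => [[/andP [srt _] /eqP E]|->].
  have [_ _ v3 _] := code_wordP srt.
  apply/ffunP => i; apply: val_inj; rewrite /= -!nth_code_seq f0E.
  by rewrite E v3.
by rewrite srt0 -w4 -sE sS eqxx.
Qed.
End Codes.

(** * The product formula for regular parameters *)

Section Assembly.
Variables (R : comNzRingType) (al be ga t : R) (r n N : nat).
Hypotheses (al_reg : GRing.lreg al) (be_reg : GRing.lreg be).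
Local Notation S := {mpoly R[n]}.
Local Notation s0 := (core_word r N).
Local Notation W := (wlen r N).
Local Notation a := (al ^+ 2 * ga).
Local Notation b := (be ^+ 2 * ga).
Local Notation c := (ga ^+ 2).
Let x (k : nat) : S := ga%:MP * @xvar R n k.

Let Hx k : ordge 1 (x k). Proof. by apply/ordgeMl/xvar_ordge. Qed.

(** The weight [vword] of the core word, common to all terms. *)
Definition norm_const := al ^+ uphalf r * be ^+ uphalf r.

Definition shape_term (la : seq nat) : S :=
  (a ^+ ((oddparts la - oddparts (delta r))./2) *
   b ^+ ((oddparts (conjp la) - oddparts (conjp (delta r)))./2) *
   c ^+ (dstat la - dstat (delta r))) *: Gdom n t la.

Lemma bounded_shape s : bounded (gridM (shape s)) (rowlen s).
Proof.
move=> i j; rewrite -nth_shape /gridM => L.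
have iL : (i < size (shape s))%N by rewrite ltnNge; apply/negP => H; rewrite nth_default in L.
have jL : (j < head 0 (shape s))%N.
  apply: leq_trans L _; rewrite -nth0 !nth_shape.
  by elim: i {iL} => // i IH; apply: leq_trans (rowlen_decr s i) IH.
by split; lia.
Qed.

Lemma head_shape s : (head 0 (shape s) <= size s - count id s)%N.
Proof. by rewrite -nth0 nth_shape; have := rowlen_bound s 0; lia. Qed.

Lemma oddholes_core : oddholes s0 = uphalf r.
Proof. by have := alt_shape s0; rewrite shape_core alt_delta; case. Qed.

Lemma conj_core : oddparts (conjp (delta r)) = uphalf r.
Proof. by rewrite -(shape_core r N) oddparts_conjp ?head_shape // oddholes_core. Qed.

Lemma even_nrows : odd (nrows r N) = false. Proof. by rewrite /nrows odd_double. Qed.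

Lemma vword_shape (B : comNzRingType) (u v : B) s : count id s = nrows r N ->
  vword u v s false false = u ^+ oddparts (shape s) * v ^+ oddholes s.
Proof.
move=> sK; have := vword_stat u v s 0; rewrite sK even_nrows /= => ->.
by rewrite oddparts_shape.
Qed.

(** All truncated subtractions and halvings in [Str] become exact. In the last equation the left
    side is the number of dominoes, so [ga] to that power supplies the factors [ga] in [a], [b] and
    [c]. *)
Lemma stats s : count id s = nrows r N -> oddalt (shape s) = oddalt (delta r) ->
  (dstat (delta r) <= dstat (shape s))%N ->
  exists u v w : nat, [/\ oddparts (shape s) = uphalf r + u.*2, oddholes s = uphalf r + v.*2,
    dstat (shape s) = dstat (delta r) + w &
    (sumn (shape s) - sumn (delta r))./2 = u + v + w.*2]%N.
Proof.
move=> sK E dd.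
have := dstat_identity (shape s); have := dstat_identity (delta r).
rewrite alt_shape alt_delta oddparts_delta E.
have [p1 [p2 [P1 P2]]] := oddalt_oddparts (shape s).
have [h1 [h2 [H1]]] := oddalt_oddholes s 0; rewrite -oddalt_shape /= addr0 => H2.
rewrite E oddalt_delta in P2 H2.
rewrite P1 H1 => I1 I2.
exists ((p1 + p2 - uphalf r)./2), ((h1 + h2 - uphalf r)./2), (dstat (shape s) - dstat (delta r))%N.
by case: (odd r) P2 H2 => P2 H2; split; lia.
Qed.

Lemma term_shape s : s \in words W -> in_range r N s ->
  vword al%:MP be%:MP s false false * paths W t%:MP x s0 n s =
  norm_const *: (if inP r (shape s) then shape_term (shape s) else 0).
Proof.
rewrite mem_words => /eqP sW /andP [/eqP sK _].
have [W0 c0 R0] := core_wordP r N.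
have OO : inP r (shape s) = (oddbeads s false == oddbeads s0 false).
  rewrite inP_oddalt ?shape_part // oddalt_shape -(shape_core r N) oddalt_shape.
  have := oddalt_oddbeads s 0; have := oddalt_oddbeads s0 0.
  rewrite sK c0 even_nrows /= => E1 E2; apply/eqP/eqP => H; lia.
case: ifP => [sP|]; last first.
  by rewrite OO scaler0 => /negbT /paths_oddbeads ->; rewrite mulr0.
have E : oddalt (shape s) = oddalt (delta r) by apply/eqP; rewrite -inP_oddalt ?shape_part.
have L := inP_contains (shape_part s) sP.
have mb : bounded (gridM (shape s)) (nth 0%N (delta r)).
  by move=> i j H; apply: bounded_shape; rewrite -nth_shape; apply: leq_trans (L i).
have dd : decr (nth 0%N (delta r)) by move=> i; rewrite !nth_delta; lia.
have sz : (size (delta r) <= size (shape s))%N.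
  rewrite leqNgt; apply/negP => H; have := L (size (shape s)).
  by rewrite [X in (_ <= X)%N]nth_default // leqn0 nth_delta subn_eq0 leqNgt -(size_delta r) H.
have [u [v [w [U V Wd D]]]] := stats sK E (leq_dstat L sz).
rewrite vword_shape // U V /x paths_scale (possum_shape sK) (possum_shape c0).
rewrite shape_core subnDr D -(TabSum_paths t mb dd W0 c0 R0) //; last exact: bounded_shape.
rewrite /shape_term U conj_core oddparts_delta oddparts_conjp ?head_shape // V Wd.
rewrite !addKn !doubleK /Gdom; have /eqP -> := sP; rewrite Gskew_TabSum //.
have -> : TabSum n (gridM (shape s)) t (nth 0%N (delta r)) n (nth 0%N (shape s)) =
   TabSum n (gridM (shape s)) t (nth 0%N (delta r)) n (rowlen s).
  by apply: eq_bigl => T; apply: eq_tabb => i; rewrite nth_shape.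
rewrite -!rmorphXn -!rmorphM mulrA -rmorphM mul_mpolyC scalerA; congr (_ *: _).
rewrite /norm_const !exprD -!mul2n !exprM !exprMn.
ring.
Qed.

Lemma lreg_ordge (z : R) k (p : S) : GRing.lreg z -> ordge k (z%:MP * p) -> ordge k p.
Proof.
move=> zr H m mk; have := H m mk; rewrite mul_mpolyC mcoeffZ => E.
by apply: zr; rewrite E mulr0.
Qed.

Lemma Vsum_Str :
  eq_upto N (Vsum W t%:MP al%:MP be%:MP x s0 n) (norm_const *: Str a b c t r n N).
Proof.
have [W0 c0 R0] := core_wordP r N.
have -> : norm_const *: Str a b c t r n N = \sum_(s <- words W | in_range r N s)
    norm_const *: (if inP r (shape s) then shape_term (shape s) else 0).
  rewrite sum_codes scaler_sumr /Str big_mkcondr /=.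
  apply: eq_bigr => f /andP [srt _]; have [_ _ _ ->] := code_wordP srt.
  by case: ifP; rewrite ?scaler0.
rewrite /Vsum big_mkcond (bigID (in_range r N)) /= [X in eq_upto _ _ X]big_mkcond /=.
rewrite /eq_upto -addrA addrC -addrA; apply: ordgeD.
  (* A word outside the range has the wrong number of beads, hence no path, or needs more than [N]
     dominoes. *)
  rewrite big_seq_cond; apply: ordge_sum => s /andP [sW]; rewrite /in_range negb_and.
  case: (eqVneq (count id s) (count id s0)) => [sK|/paths_count -> _]; last first.
    by rewrite mulr0; apply: ordge_zero.
  rewrite sK c0 eqxx /= -ltnNge => L; apply: ordgeMl; apply: ordgeW (@paths_ordge _ _ W t%:MP x s0 Hx n s).
  rewrite (possum_shape (etrans sK c0)) (possum_shape c0) shape_core; move: L; rewrite /maxsize; lia.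
rewrite addrC -[X in _ - X]big_mkcond /= big_seq_cond [X in _ - X]big_seq_cond -sumrB big1 => [|s /andP [sW sI]].
  exact: ordge_zero.
by rewrite term_shape // subrr.
Qed.

Lemma xE (i : 'I_n) : x i = ga *: 'X_i.
Proof. by rewrite /x /xvar valK mul_mpolyC. Qed.

Lemma prod_ltn (F : 'I_n -> 'I_n -> S) :
  \prod_(i < n) \prod_(j < n | (i < j)%N) F i j =
  \prod_(i < n) \prod_(j < n | (j < i)%N) F j i.
Proof.
rewrite (exchange_big_dep xpredT) //=.
Qed.

Lemma Sden_prod :
  \prod_(i < n) ((1 - be%:MP ^+ 2 * x i) * (1 - t%:MP ^+ 2 * x i ^+ 2) * Gprod t%:MP x i (x i))
  = Sden n b c t.
Proof.
(* [Gprod] pairs [x i] with the earlier variables, so the double products are first turned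
   around. *)
rewrite /Sden !prod_ltn -!big_split /=; apply: eq_bigr => i _.
rewrite -[RHS]mulrA; congr (_ * _ * _).
- by rewrite xE -!mul_mpolyC !(rmorphM, rmorphXn) /=; ring.
- by rewrite xE -!mul_mpolyC !(rmorphM, rmorphXn) /=; ring.
rewrite -big_split /Gprod /=.
rewrite (big_ord_widen_cond n xpredT (fun j => fc t%:MP (x i) (x j))) ?(ltnW (ltn_ord i)) //=.
apply: eq_bigr => j _; rewrite /fc !xE -!mul_mpolyC !(rmorphM, rmorphXn) /=; ring.
Qed.

Lemma Snum_prod :
  \prod_(i < n) (1 + al%:MP ^+ 2 * t%:MP * x i) = Snum n a t.
Proof.
by apply: eq_bigr => i _; rewrite xE -!mul_mpolyC !(rmorphM, rmorphXn) /=; ring.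
Qed.

Lemma Str_regular : eq_upto N (Str a b c t r n N * Sden n b c t) (Snum n a t).
Proof.
have [W0 c0 R0] := core_wordP r N.
have Hbe k (p : S) : ordge k (be%:MP * p) -> ordge k p by apply: lreg_ordge.
have := Vsum_total t%:MP al%:MP Hx W0 (@core_padded r N) (@core_sexp r N) Hbe n.
rewrite Sden_prod Snum_prod vword_shape // shape_core oddparts_delta oddholes_core => H.
have {}H := eq_upto_trans (eq_upto_sym (eq_upto_mull (Sden n b c t) Vsum_Str)) H.
apply: (@lreg_ordge norm_const).
  by apply: lregM; apply: lregX.
suff -> : norm_const%:MP * (Str a b c t r n N * Sden n b c t - Snum n a t) =
  Sden n b c t * (norm_const *: Str a b c t r n N) -
  Snum n a t * (al%:MP ^+ uphalf r * be%:MP ^+ uphalf r) by [].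
by rewrite -mul_mpolyC /norm_const rmorphM !rmorphXn /=; ring.
Qed.
End Assembly.

(** * Change of ring *)

Section BaseChange.
Variables (A B : comNzRingType) (f : {rmorphism A -> B}) (n : nat).
Local Notation mf := (@map_mpoly n A B f).

Lemma map_Gskew la mu t : mf (Gskew n la mu t) = Gskew n la mu (f t).
Proof.
rewrite /Gskew rmorph_sum; apply: eq_bigr => T _ /=.
rewrite map_mpolyZ rmorphXn /=; congr (_ *: _); rewrite /xweight rmorph_prod.
apply: eq_bigr => x _ /=; case: (T x) => [[l d]|]; last by rewrite rmorph1.
by case: ifP => _; rewrite ?map_mpolyX ?rmorph1.
Qed.

Lemma map_Str a b c t r N : mf (Str a b c t r n N) = Str (f a) (f b) (f c) (f t) r n N.
Proof.
rewrite /Str rmorph_sum; apply: eq_bigr => s _ /=.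
by rewrite map_mpolyZ map_Gskew !rmorphM !rmorphXn.
Qed.

Lemma map_Snum a t : mf (Snum n a t) = Snum n (f a) (f t).
Proof.
rewrite /Snum rmorph_prod; apply: eq_bigr => i _ /=.
by rewrite rmorphD rmorph1 /= map_mpolyZ map_mpolyX rmorphM.
Qed.

Lemma map_Sden b c t : mf (Sden n b c t) = Sden n (f b) (f c) (f t).
Proof.
rewrite /Sden !rmorphM !rmorph_prod; congr (_ * _ * _ * _); apply: eq_bigr => i _ /=.
- by rewrite rmorphB rmorph1 /= map_mpolyZ map_mpolyX.
- by rewrite rmorphB rmorph1 /= map_mpolyZ (rmorphXn mf) /= map_mpolyX rmorphM rmorphXn.
- rewrite rmorph_prod; apply: eq_bigr => j _ /=.
  by rewrite rmorphB rmorph1 /= map_mpolyZ (rmorphM mf) /= !map_mpolyX.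
- rewrite rmorph_prod; apply: eq_bigr => j _ /=.
  by rewrite rmorphB rmorph1 /= map_mpolyZ (rmorphM mf) /= !map_mpolyX rmorphM rmorphXn.
Qed.
End BaseChange.

Section Universal.
Variable R : comNzRingType.
Local Notation A := {mpoly R[3]}.
Let i0 : 'I_3 := @Ordinal 3 0 isT.
Let i1 : 'I_3 := @Ordinal 3 1 isT.
Let i2 : 'I_3 := @Ordinal 3 2 isT.

(** 'X_0 |-> 'X_0^2 'X_2, 'X_1 |-> 'X_1^2 'X_2 and 'X_2 |-> 'X_2^2. *)
Definition psubst_exp (i : 'I_3) : 'X_{1..3} :=
  (if i == i2 then U_(i2) *+ 2 else U_(i) *+ 2 + U_(i2))%MM.

Definition psubst_mnm (m : 'X_{1..3}) : 'X_{1..3} := (\sum_(i < 3) (psubst_exp i *+ m i))%MM.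

Definition psubst : A -> A := comp_mpoly [tuple 'X_[psubst_exp i] | i < 3].
HB.instance Definition _ := GRing.RMorphism.on psubst.

Lemma ord3P (i : 'I_3) : [\/ i = i0, i = i1 | i = i2].
Proof.
by case: i => [[|[|[|i]]] Hi] //; [apply: Or31 | apply: Or32 | apply: Or33]; apply: val_inj.
Qed.

(** The exponents undergo a triangular linear map with diagonal entries 2. *)
Lemma psubst_mnm_inj : injective psubst_mnm.
Proof.
move=> m m' E.
have S (u : 'X_{1..3}) j : psubst_mnm u j = (psubst_exp i0 j * u i0 + psubst_exp i1 j * u i1 + psubst_exp i2 j * u i2)%N.
  rewrite /psubst_mnm mnm_sumE !big_ord_recl big_ord0 /= !mulmnE addn0 !addnA.
  by congr (_ * u _ + _ * u _ + _ * u _)%N; try congr (psubst_exp _ j); apply: val_inj.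
have V i j : psubst_exp i j = (2 * (i == j) + (i != i2) * (i2 == j))%N.
  rewrite /psubst_exp; case: (eqVneq i i2) => [->|_].
    by rewrite mulmnE !mnm1E; lia.
  by rewrite mnmDE mulmnE !mnm1E; lia.
have [E0 E1 E2] : [/\ psubst_mnm m i0 = psubst_mnm m' i0, psubst_mnm m i1 = psubst_mnm m' i1 &
  psubst_mnm m i2 = psubst_mnm m' i2] by rewrite E.
move: E0 E1 E2; rewrite !S !V /= => E0 E1 E2.
by apply/mnmP => i; case: (ord3P i) => ->; lia.
Qed.

Lemma psubstX i : psubst 'X_i = 'X_[psubst_exp i].
Proof. by rewrite /psubst comp_mpolyXU -tnth_nth tnth_mktuple. Qed.

Lemma mcoeff_subst (p : A) m : (psubst p)@_(psubst_mnm m) = p@_m.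
Proof.
rewrite /psubst comp_mpolyEX [in RHS](mpolyE p) !raddf_sum; apply: eq_bigr => k _ /=.
rewrite !mcoeffZ mcoeffX comp_mpolyX; congr (_ * _).
rewrite (eq_bigr (fun i => 'X_[R, psubst_exp i] ^+ k i)) => [|i _]; last by rewrite tnth_mktuple.
by rewrite mprodXnE mcoeffX (inj_eq psubst_mnm_inj).
Qed.

Lemma psubst_inj (p : A) : psubst p = 0 -> p = 0.
Proof. by move=> H; apply/mpolyP => m; rewrite -mcoeff_subst H !mcoeff0. Qed.

Lemma lregX_mpoly (i : 'I_3) : GRing.lreg ('X_i : A).
Proof.
move=> p q E; apply/mpolyP => m.
by rewrite -[LHS](mcoeffMX _ U_(i)) -[RHS](mcoeffMX _ U_(i)) ![_ * 'X_i]mulrC E.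
Qed.

Lemma Str_product (a b c t : R) r n N :
  eq_upto N (Str a b c t r n N * Sden n b c t) (Snum n a t).
Proof.
pose T : A := t%:MP.
(* The identity for indeterminate [a], [b], [c] is tested coefficientwise after the injective
   [psubst], where it has the form of [Str_regular] with the indeterminates as regular [al] and
   [be]. *)
have U : eq_upto N (Str 'X_i0 'X_i1 'X_i2 T r n N * Sden n 'X_i1 'X_i2 T) (Snum n 'X_i0 T).
  move=> m Hm; apply: psubst_inj; rewrite -mcoeff_map_mpoly.
  rewrite rmorphB rmorphM [X in X@__]/= map_Str map_Sden map_Snum.
  have S0 : psubst 'X_i0 = 'X_i0 ^+ 2 * 'X_i2 by rewrite psubstX mpolyXD mpolyXn.
  have S1 : psubst 'X_i1 = 'X_i1 ^+ 2 * 'X_i2 by rewrite psubstX mpolyXD mpolyXn.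
  have S2 : psubst 'X_i2 = 'X_i2 ^+ 2 by rewrite psubstX mpolyXn.
  have ST : psubst T = T by rewrite /psubst comp_mpolyC.
  rewrite [_ 'X_i2]S2 [_ T]ST [_ 'X_i0]S0 [_ 'X_i1]S1.
  exact: (@Str_regular A 'X_i0 'X_i1 'X_i2 T r n N (@lregX_mpoly i0) (@lregX_mpoly i1) m Hm).
pose ev : {rmorphism A -> R} := meval (tnth [tuple a; b; c]).
move=> m Hm; have := U m Hm => /(congr1 ev).
rewrite -mcoeff_map_mpoly rmorphB rmorphM [X in X@__]/= map_Str map_Sden map_Snum rmorph0.
by rewrite /ev /= !mevalXU mevalC !(tnth_nth 0).
Qed.
End Universal.

Lemma Sden_const (R : comNzRingType) n (b c t : R) : ordge 1 (Sden n b c t - 1).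
Proof.
have M (p q : {mpoly R[n]}) : ordge 1 (p - 1) -> ordge 1 (q - 1) -> ordge 1 (p * q - 1).
  move=> Hp Hq; have -> : p * q - 1 = q * (p - 1) + (q - 1) by ring.
  exact/ordgeD/Hq/ordgeMl.
have P (I : Type) (s : seq I) (Q : pred I) (F : I -> {mpoly R[n]}) :
    (forall i, ordge 1 (F i - 1)) -> ordge 1 (\prod_(i <- s | Q i) F i - 1).
  by move=> H; elim/big_ind: _ => //; rewrite subrr; apply: ordge_zero.
have X1 (i : 'I_n) : ordge 1 ('X_i : {mpoly R[n]}).
  by have := @xvar_ordge R n i; rewrite /xvar valK.
have F1 (u : R) p : ordge 1 p -> ordge 1 (1 - u *: p - 1).
  by move=> Hp; rewrite addrC addKr; apply: ordgeN; rewrite -mul_mpolyC; apply: ordgeMl.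
apply: (M); first apply: (M); first apply: (M).
- by apply: (P) => i; apply: F1.
- by apply: (P) => i; apply: F1; rewrite expr2; apply: ordgeMl.
- by apply: (P) => i; apply: (P) => j; apply: F1; apply: ordgeMl.
- by apply: (P) => i; apply: (P) => j; apply: F1; apply: ordgeMl.
Qed.

(** In e = e d - e (d - 1) the factor d - 1 has no constant term, so each pass raises the known
    order of e by one, until the order of e d is reached. *)
Lemma eq_upto_cancel (R : comNzRingType) n N (p q d : {mpoly R[n]}) :
  ordge 1 (d - 1) -> eq_upto N (p * d) (q * d) -> eq_upto N p q.
Proof.
move=> Hd; rewrite /eq_upto -mulrBl; move: (p - q) => e H.
suff K k : (k <= N.+1)%N -> ordge k e by apply: K.
elim: k => [|k IH] kN; first exact: ordge0.
have -> : e = e * d - e * (d - 1) by ring.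
apply: ordgeB; first exact: ordgeW H.
by rewrite -addn1; apply: ordgeM => //; apply/IH/ltnW.
Qed.

Lemma eq_upto_trunc (R : comNzRingType) n N (p q : {mpoly R[n]}) : eq_upto N p q -> trunc_eq N p q.
Proof. by move=> H m Hm; apply/eqP; rewrite -subr_eq0 -mcoeffB H. Qed.

Theorem theorem5p3 (R : comRingType) (a b c t : R) :
  (forall (r r' n N : nat),
      trunc_eq N (Str a b c t r n N) (Str a b c t r' n N)) /\
  (forall (r n N : nat),
      trunc_eq N (Str a b c t r n N * Sden n b c t) (Snum n a t)).
Proof.
split=> [r r' n N|r n N]; apply: eq_upto_trunc; last exact: Str_product.
have H k : eq_upto N (Str a b c t k n N * Sden n b c t) (Snum n a t) by apply: Str_product.
(* The right side does not involve the core, and [Sden] has constant term 1, so it can be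
   cancelled. *)
exact: (eq_upto_cancel (@Sden_const R n b c t) (eq_upto_trans (H r) (eq_upto_sym (H r')))).
Qed.
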